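(* Let $L$ be a Lie ring, $\gamma: L \to L$ an endomorphism of the Lie ring, and $r(t) = \sum_{i=0}^d a_i t^i \in \mathbb{Z}[t]$ a good polynomial of degree $d$ with $r(\gamma) = 0_L$, i.e. $\sum_i a_i \gamma^i(v) = 0$ for all $v\in L$. Suppose $(L,+)$ has no $(\operatorname{Discr}_\ast(r(t)) \cdot \operatorname{Prod}_\ast(r(t)))$-torsion. Then $L$ is nilpotent of class $\operatorname{c}(L) \le d^{2^d}$.
   Context: With $\mathbb{N}=\{1,2,\dots\}$, $r(t)\in\mathbb{Z}[t]$ is bad if there exist $u\in\mathbb{N}$ and $s(t)\in\mathbb{Z}[t]\setminus\mathbb{Z}$ with $s(t^{u+1})\mid r(0)r(1)r(t)$ in $\mathbb{Z}[t]$; otherwise good. If $r$ is constant, $\operatorname{Discr}_\ast(r) := r$, $\operatorname{Prod}_\ast(r) := 1$. Otherwise with $d=\deg r$, leading coefficient $a$, distinct roots $\lambda_1,\dots,\lambda_l\in\overline{\mathbb{Q}}$ of multiplicities $m_1,\dots,m_l$, $m=\max m_i$: $\operatorname{Discr}_\ast(r) := a^{1+2d^2}(m-1)!\prod_{i\ne j}(\lambda_i-\lambda_j)^m$ and $\operatorname{Prod}_\ast(r) := a^{2d^3}\prod_{1\le i,j\le l,\ r(\lambda_i\lambda_j)\ne0} r(\lambda_i\lambda_j)$. An abelian group $(A,+)$ has $n$-torsion if some nonzero $v$ satisfies $n v = 0$. *)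

(* Defs.v *)
From mathcomp Require Import all_boot all_order all_algebra all_field.
Set Implicit Arguments. Unset Strict Implicit. Unset Printing Implicit Defensive.
Import Order.TTheory GRing.Theory Num.Theory.
Local Open Scope ring_scope.

Definition lie_ring (L : zmodType) (br : L -> L -> L) : Prop :=
  [/\ forall x y z, br (x + y) z = br x z + br y z,
      forall x y z, br x (y + z) = br x y + br x z,
      forall x, br x x = 0
    & forall x y z, br x (br y z) + br y (br z x) + br z (br x y) = 0].

Definition lie_endo (L : zmodType) (br : L -> L -> L) (g : L -> L) : Prop :=
  (forall x y, g (x + y) = g x + g y) /\ (forall x y, g (br x y) = br (g x) (g y)).

Inductive lcs (L : zmodType) (br : L -> L -> L) : nat -> L -> Prop :=
  | lcs_base x : lcs br 1 x
  | lcs_br k x y : lcs br k.+1 x -> lcs br k.+2 (br x y)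
  | lcs_zero k : lcs br k.+2 0
  | lcs_add k x y : lcs br k.+2 x -> lcs br k.+2 y -> lcs br k.+2 (x + y)
  | lcs_opp k x : lcs br k.+2 x -> lcs br k.+2 (- x).

Definition nilpotent_class_le (L : zmodType) (br : L -> L -> L) (c : nat) : Prop :=
  forall x, lcs br c.+1 x -> x = 0.

Definition has_torsion (A : zmodType) (n : int) : Prop :=
  exists v : A, v != 0 /\ v *~ n = 0.

Definition zdvdp (s p : {poly int}) : Prop := exists q : {poly int}, p = q * s.

Definition bad_poly (r : {poly int}) : Prop :=
  exists (u : nat) (s : {poly int}), (0 < u)%N /\ (1 < size s)%N /\
    zdvdp (s \Po 'X^(u.+1)) ((r.[0] * r.[1]) *: r).
Definition good_poly (r : {poly int}) : Prop := ~ bad_poly r.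

Definition rC (r : {poly int}) : {poly algC} := map_poly intr r.

Definition roots_mult (r : {poly int}) : seq algC :=
  sval (closed_field_poly_normal (rC r)).
Definition droots (r : {poly int}) : seq algC := undup (roots_mult r).
Definition maxmult (r : {poly int}) : nat :=
  (\max_(x <- droots r) count_mem x (roots_mult r))%N.

Definition Discr_star (r : {poly int}) : algC :=
  if (size r <= 1)%N then (r`_0)%:~R else
  let d := (size r).-1 in let a : algC := (lead_coef r)%:~R in
  let m := maxmult r in
  a ^+ (1 + 2 * d ^ 2) * ((m.-1)`!)%:R *
  \prod_(i <- droots r) \prod_(j <- droots r | i != j) (i - j) ^+ m.

Definition Prod_star (r : {poly int}) : algC :=
  if (size r <= 1)%N then 1 else
  let d := (size r).-1 in let a : algC := (lead_coef r)%:~R in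
  a ^+ (2 * d ^ 3) *
  \prod_(i <- droots r) \prod_(j <- droots r | (rC r).[i * j] != 0) (rC r).[i * j].

(* Main.v *)
From HB Require Import structures.
Require Import Defs.
From mathcomp Require Import all_boot all_order all_algebra all_field.
From mathcomp Require Import zify ring lra.
From Stdlib Require Import Classical Permutation.
Set Implicit Arguments. Unset Strict Implicit. Unset Printing Implicit Defensive.
Import Order.TTheory GRing.Theory Num.Theory.
Local Open Scope ring_scope.

(** Write [a] for the leading coefficient of [r], [X] for its set of roots and
    [N = Discr_* r * Prod_* r], which is an integer: it is Galois invariant, and the
    powers of [a] in it clear all denominators.  Let [S] be a subring of the algebraic
    integers, free of finite rank over the integers, that contains every [a x], [x] in [X].
    In [L (x) S], which contains [L] and has no [N]-torsion, let [C x] be the generalized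
    eigenspace of [g] for [x].  Every vector lies in the sum of the [C x] after
    multiplication by a power of [N], because the [a (x - y)] divide [N]; and [[C x, C y]]
    lies in [C (x y)], or vanishes when [x y] is not a root, because [a^(2d) r(x y)] then
    divides [N].  So it suffices to bound the class of a Lie ring graded by [X].

    Since [r] is good, [X] contains neither 0 nor 1 and no progression
    [x, x y, x y^2, ...] with [x, y] in [X].  List [X] by argument in [[0, 2 pi)], ties
    broken by modulus; then no element is the product of an earlier and a later one, and
    Kreknin's elimination of weights, one at a time, gives derived length at most
    [2^|X| - 1].  If an abelian section is acted on by [d] commuting homogeneous operators,
    their order can be chosen so that the weight leaves [X]; hence passing from the
    commutator ideal, of class [c], to the whole ring gives class at most [d c + 1]. *)

(** * Graded Lie rings *)

Inductive zspan (V : zmodType) (P : V -> Prop) : V -> Prop :=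
  | zspan_gen v : P v -> zspan P v
  | zspan0 : zspan P 0
  | zspanB v w : zspan P v -> zspan P w -> zspan P (v - w).

Lemma zspanN (V : zmodType) (P : V -> Prop) v : zspan P v -> zspan P (- v).
Proof. by move=> Pv; rewrite -sub0r; apply: zspanB => //; apply: zspan0. Qed.

Lemma zspanD (V : zmodType) (P : V -> Prop) v w :
  zspan P v -> zspan P w -> zspan P (v + w).
Proof. by move=> Pv Pw; rewrite -[w]opprK; apply: zspanB => //; apply: zspanN. Qed.

Lemma zspanMz (V : zmodType) (P : V -> Prop) v (n : int) :
  zspan P v -> zspan P (v *~ n).
Proof.
move=> Pv; have nat_case k : zspan P (v *+ k).
  by elim: k => [|k IH]; [apply: zspan0 | rewrite mulrS; apply: zspanD].
by case: n => k; rewrite ?NegzE ?mulrNz -?pmulrn //; apply: zspanN.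
Qed.

Definition sub_closed (V : zmodType) (P : V -> Prop) : Prop :=
  P 0 /\ forall v w, P v -> P w -> P (v - w).

Lemma zspan_closed (V : zmodType) (P : V -> Prop) : sub_closed (zspan P).
Proof. by split; [apply: zspan0 | apply: zspanB]. Qed.

Lemma zspan_min (V : zmodType) (P Q : V -> Prop) :
  sub_closed Q -> (forall v, P v -> Q v) -> forall v, zspan P v -> Q v.
Proof. by case=> Q0 QB PQ v; elim=> // {}v w _ Qv _ Qw; apply: QB. Qed.

Lemma sub_closedD (V : zmodType) (P : V -> Prop) v w :
  sub_closed P -> P v -> P w -> P (v + w).
Proof.
by case=> P0 PB Pv Pw; rewrite -[w]opprK; apply: (PB) => //; rewrite -sub0r; apply: PB.
Qed.

Section GradedLie.

Variables (F : fieldType) (V : zmodType) (br : V -> V -> V).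
Hypothesis brDl : forall x y z, br (x + y) z = br x z + br y z.
Hypothesis brDr : forall x y z, br x (y + z) = br x y + br x z.
(** The Jacobi identity in the form used throughout: right multiplication by [z] is a derivation. *)
Hypothesis brJ : forall x y z, br (br x y) z = br (br x z) y + br x (br y z).

Lemma br0l v : br 0 v = 0.
Proof. by apply: (@addrI _ (br 0 v)); rewrite -brDl !addr0. Qed.
Lemma br0r v : br v 0 = 0.
Proof. by apply: (@addrI _ (br v 0)); rewrite -brDr !addr0. Qed.
Lemma brBl x y z : br (x - y) z = br x z - br y z.
Proof. by apply: (@addIr _ (br y z)); rewrite -brDl !subrK. Qed.
Lemma brBr x y z : br x (y - z) = br x y - br x z.
Proof. by apply: (@addIr _ (br x z)); rewrite -brDr !subrK. Qed.

(** A graded subset is given by its components alone. They need not be independent, so no sum of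
    components has to be shown direct. *)
Definition wfamily := F -> V -> Prop.
Definition subfam (A B : wfamily) := forall x v, A x v -> B x v.
Lemma subfam_refl A : subfam A A. Proof. by []. Qed.
#[local] Hint Resolve subfam_refl : core.
Definition fam_closed (A : wfamily) := forall x, sub_closed (A x).

Definition gbr (A B : wfamily) : wfamily := fun x =>
  zspan (fun u => exists y z v w, [/\ y * z = x, A y v, B z w & u = br v w]).

Lemma gbr_closed A B : fam_closed (gbr A B).
Proof. by move=> x; apply: zspan_closed. Qed.

Lemma gbr_mem (A B : wfamily) y z v w : A y v -> B z w -> gbr A B (y * z) (br v w).
Proof. by move=> Av Bw; apply: zspan_gen; exists y, z, v, w. Qed.

Lemma gbr_min (A B Q : wfamily) : fam_closed Q ->
  (forall y z v w, A y v -> B z w -> Q (y * z) (br v w)) -> subfam (gbr A B) Q.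
Proof.
move=> clQ ABQ x v; apply: zspan_min => // _ [y [z [v1 [w [<- Av Bw ->]]]]].
exact: ABQ.
Qed.

Lemma gbrS A A' B B' :
  subfam A A' -> subfam B B' -> subfam (gbr A B) (gbr A' B').
Proof.
by move=> sA sB; apply: gbr_min (@gbr_closed _ _) _ => y z v w /sA Av /sB; apply: gbr_mem.
Qed.


Lemma closed_brl (Q : wfamily) x w :
  fam_closed Q -> sub_closed (fun v => Q x (br v w)).
Proof.
move=> clQ; have [Q0 QB] := clQ x; split=> [|u v Qu Qv]; first by rewrite br0l.
by rewrite brBl; apply: QB.
Qed.

(** A graded three subgroups lemma: [brJ] splits the double bracket, and commutativity of the
    weights keeps both terms in the same degree. *)
Lemma gbr_jacobi (A B D Q : wfamily) : fam_closed Q ->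
  subfam (gbr (gbr A D) B) Q -> subfam (gbr A (gbr B D)) Q ->
  subfam (gbr (gbr A B) D) Q.
Proof.
move=> clQ H1 H2; apply: gbr_min => // y z v w ABv Dw.
move: v ABv; apply: zspan_min; first exact: closed_brl.
move=> _ [y1 [y2 [v1 [v2 [<- Av Bv ->]]]]]; rewrite brJ.
apply: sub_closedD => //.
  by apply: H1; rewrite mulrAC; apply/gbr_mem/Bv/gbr_mem.
by apply: H2; rewrite -mulrA; apply/gbr_mem/gbr_mem.
Qed.

(** The derived series with the commutator taken innermost, so that induction on [s] replaces [A] by
    [gbr A A]; [gderSr] is the outer recursion. *)
Fixpoint gder (s : nat) (A : wfamily) : wfamily :=
  if s is s'.+1 then gder s' (gbr A A) else A.

(** Counted from 0: [glcs A k] is the term usually numbered [k + 1], and it vanishes when the class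
    is at most [k]. *)
Fixpoint glcs (A : wfamily) (k : nat) : wfamily :=
  if k is k'.+1 then gbr (glcs A k') A else A.

Definition lie_closed (A : wfamily) := fam_closed A /\ subfam (gbr A A) A.

Lemma lie_closed_gbr A : lie_closed A -> lie_closed (gbr A A).
Proof. by case=> clA sA; split; [apply: gbr_closed | apply: gbrS]. Qed.

Lemma lie_closed_gder s A : lie_closed A -> lie_closed (gder s A).
Proof. by elim: s A => //= s IH A cA; apply/IH/lie_closed_gbr. Qed.

Lemma gder_sub s A : lie_closed A -> subfam (gder s A) A.
Proof.
elim: s A => //= s IH A cA x v /(IH _ (lie_closed_gbr cA)).
by case: cA => _; apply.
Qed.

Lemma gderD s t A : gder (s + t) A = gder s (gder t A).
Proof. by elim: t A => [|t IH] A; rewrite ?addn0 // addnS /= IH. Qed.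

Lemma gderSr s A : gder s.+1 A = gbr (gder s A) (gder s A).
Proof. by elim: s A => //= s IH A; rewrite -IH. Qed.

Variables (X : seq F) (C : wfamily).
Hypothesis C_lie : lie_closed C.
Hypothesis C_supp : forall x v, C x v -> x \notin X -> v = 0.

Inductive gen (Y : seq F) (A : wfamily) : wfamily :=
  | gen_in y v : y \in Y -> A y v -> gen Y A y v
  | gen0 x : gen Y A x 0
  | genB x v w : gen Y A x v -> gen Y A x w -> gen Y A x (v - w)
  | gen_br y z v w : gen Y A y v -> gen Y A z w -> gen Y A (y * z) (br v w).

Lemma gen_closed Y A : fam_closed (gen Y A).
Proof. by move=> x; split; [apply: gen0 | apply: genB]. Qed.

Lemma gen_min Y (A Q : wfamily) : lie_closed Q ->
  (forall y v, y \in Y -> A y v -> Q y v) -> subfam (gen Y A) Q.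
Proof.
move=> [clQ brQ] AQ x v; elim=> {x v} [y v Yy Av|x|x v w _ Qv _ Qw|].
- exact: AQ.
- by case: (clQ x).
- by case: (clQ x) => _; apply.
by move=> y z v w _ Qv _ Qw; apply/brQ/gbr_mem.
Qed.

Lemma gen_lie Y A : lie_closed (gen Y A).
Proof.
split; first exact: gen_closed.
by apply: gbr_min (@gen_closed _ _) _ => *; apply: gen_br.
Qed.

(** The derivation rule turns [br v (br w1 w2)] into [br (br v w1) w2 - br (br v w2) w1], whose
    inner brackets stay in [A]. So a right factor from the generated subring breaks down to single
    generators. *)
Lemma gbr_gen Y A : lie_closed A ->
  subfam (gbr A (gen Y A)) (gbr A (fun y v => y \in Y /\ A y v)).
Proof.
move=> [clA brA]; apply: gbr_min (@gbr_closed _ _) _ => y z v w Av gw.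
have genA : subfam (gen Y A) A by apply: gen_min.
elim: gw y v Av => {z w} [z w Yz Aw|z|z w1 w2 _ IH1 _ IH2|z1 z2 w1 w2 g1 IH1 g2 IH2] y v Av.
- exact: gbr_mem.
- by rewrite br0r; apply: zspan0.
- by rewrite brBr; apply: zspanB; [apply: IH1 | apply: IH2].
have -> : br v (br w1 w2) = br (br v w1) w2 - br (br v w2) w1.
  by rewrite [br (br v w1) w2]brJ addrAC subrr add0r.
apply: zspanB.
  by rewrite mulrA; apply/IH2/brA/gbr_mem => //; apply: genA.
by rewrite (mulrC z1) mulrA; apply/IH1/brA/gbr_mem => //; apply: genA.
Qed.

Definition no_middle (Y : seq F) := forall R x Y' z y,
  Y = R ++ x :: Y' -> z \in R -> y \in Y' -> z * y <> x.

Hypothesis X_mid : no_middle X.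
Hypotheses (X0 : 0 \notin X) (X1 : 1 \notin X).

(* Kreknin's argument: each step discards the first of the remaining weights. *)
Lemma gder_gen R Y A : X = R ++ Y -> lie_closed A -> subfam A C ->
  subfam (gder (2 ^ size R).-1 A) (gen Y A).
Proof.
elim/last_ind: R Y A => [|R x IH] Y A defX cA sAC.
  move=> x v /= Av; have [Xx|nXx] := boolP (x \in X).
    by apply: gen_in; rewrite // -[Y]/([::] ++ Y) -defX.
  by rewrite (C_supp (sAC _ _ Av) nXx); apply: gen0.
(* The induction hypothesis is used twice: on [M], obtained from [A] by [s.+1] derivations, to leave
   only generators with weight in [x :: Y], and on [A], to rewrite those of weight [x]. *)
rewrite cat_rcons in defX; set s := (2 ^ size R).-1.
have -> : (2 ^ size (rcons R x)).-1 = (s + s.+1)%N.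
  by rewrite size_rcons expnS /s; have := expn_gt0 2 (size R); lia.
have cM := lie_closed_gder s.+1 cA; set M := gder s.+1 A in cM *.
have sMA : subfam M A by apply: gder_sub.
have cE := lie_closed_gder s cA.
rewrite gderD -/M => z v /(IH _ M defX cM) Mv.
have {}Mv : gen (x :: Y) M z v by apply: Mv => ? ? /sMA /sAC.
move: z v Mv; apply: gen_min; first exact: gen_lie.
move=> y v; rewrite inE => /predU1P[->{y}|Yy Mv]; last first.
  by apply: gen_in => //; apply: sMA.
rewrite /M gderSr => Mv.
have {}Mv : gbr A (fun y v => y \in x :: Y /\ A y v) x v.
  apply: gbr_gen => //; apply: gbrS Mv; first exact: gder_sub.
  exact: IH.
move: v Mv; apply: zspan_min; first exact: gen_closed.
move=> _ [z [y [v [w [defx Av [xYy Aw] ->]]]]].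
have [Xz|nXz] := boolP (z \in X); last first.
  by rewrite (C_supp (sAC _ _ Av) nXz) br0l; apply: gen0.
have Xx : x \in X by rewrite defX mem_cat inE eqxx orbT.
have nzx : x != 0 by apply: contraNneq X0 => <-.
(* Now [z * y = x]. Neither factor is [x], since [x] is nonzero and 1 is not a weight, and [X_mid]
   keeps [z] out of [R]; so both weights lie in [Y]. *)
move: xYy; rewrite inE => /predU1P[yx|Yy].
  case/negP: X1; rewrite -(_ : z = 1) //; apply: (mulIf nzx).
  by rewrite mul1r -{1}yx defx.
have Xy : y \in X by rewrite defX mem_cat inE Yy !orbT.
have Yz : z \in Y.
  move: (Xz); rewrite defX mem_cat inE => /or3P[Rz|/eqP zx|//].
    by have := X_mid defX Rz Yy; rewrite defx.
  case/negP: X1; rewrite -(_ : y = 1) //; apply: (mulfI nzx).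
  by rewrite mulr1 -{1}zx defx.
by rewrite -defx; apply: gen_br; apply: gen_in.
Qed.

(** Once all weights are discarded, the subring has no generators left and is zero. *)
Lemma gder_eq0 x v : gder (2 ^ size X).-1 C x v -> v = 0.
Proof.
have H := @gder_gen X [::] C; rewrite cats0 in H.
move/(H erefl C_lie (fun _ _ h => h)).
have: lie_closed (fun _ v => v = 0).
  split=> [y|]; first by split=> // u w -> ->; rewrite subr0.
  by apply: gbr_min => [y|y z u w -> _]; [split=> // ? ? -> ->; rewrite subr0 | rewrite br0l].
by move=> cl0; apply: (gen_min cl0).
Qed.

(** * From derived length to nilpotency class *)

Hypothesis X_free : forall x y, x \in X -> y \in X -> exists n, x * y ^+ n \notin X.
Variable d : nat.
Hypothesis Xd : (size (undup X) <= d)%N.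

Fixpoint subprods (x : F) (ys : seq F) : seq F :=
  if ys is y :: t then subprods x t ++ [seq z * y | z <- subprods x t] else [:: x].

Lemma subprods_base x ys : x \in subprods x ys.
Proof. by elim: ys => [|y t IH]; rewrite ?inE //= mem_cat IH. Qed.

(* If adding y creates no new product, the set of products is stable under y and
   contains a whole progression. *)
Lemma size_subprods x ys : x \in X -> {subset ys <= X} ->
  {subset subprods x ys <= X} -> (size ys < size (undup (subprods x ys)))%N.
Proof.
move=> Xx; elim: ys => //= y t IH ysX sX.
have sX' : {subset subprods x t <= X} by move=> z zt; apply: sX; rewrite mem_cat zt.
have tX : {subset t <= X} by move=> z zt; apply: ysX; rewrite inE zt orbT.
apply: leq_ltn_trans (IH tX sX') _.
set S := subprods x t in sX sX' *.
have sub : {subset undup S <= undup (S ++ [seq z * y | z <- S])}.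
  by move=> z; rewrite !mem_undup mem_cat => ->.
rewrite ltnNge; apply/negP => le.
have [_ eqS] := uniq_min_size (undup_uniq S) sub le.
have stable z : z \in S -> z * y \in S.
  move=> Sz; have := eqS (z * y).
  by rewrite !mem_undup mem_cat => ->; rewrite (map_f (fun z => z * y) Sz) orbT.
have [n] := X_free Xx (ysX y (mem_head _ _)); case/negP; apply: sX'.
elim: n => [|n IHn]; first by rewrite mulr1 /S subprods_base.
by rewrite exprSr mulrA stable.
Qed.

(** Turns a subproduct into a rearrangement of the operators in which the chosen factors act
    first. *)
Lemma subprods_split (fs : seq (F * V)) x z : z \in subprods x (map fst fs) ->
  exists fs1 fs2, Permutation fs (fs1 ++ fs2) /\ z = x * \prod_(f <- fs1) f.1.
Proof.
elim: fs z => [|f fs IH] z /=.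
  by rewrite inE => /eqP->; exists [::], [::]; rewrite big_nil mulr1; split=> //; apply: perm_nil.
rewrite mem_cat => /orP[/IH[fs1 [fs2 [p ->]]]|/mapP[z' /IH[fs1 [fs2 [p ->]]] ->]].
  exists fs1, (f :: fs2); split=> //; apply: perm_trans (perm_skip f p) _.
  exact: Permutation_middle.
exists (f :: fs1), fs2; split; first exact: perm_skip.
by rewrite big_cons mulrCA mulrC.
Qed.

(** A left-normed bracket; each operator carries its weight as first component. *)
Definition brs (m : V) (fs : seq (F * V)) := foldl (fun u f => br u f.2) m fs.

Section Ideals.

Variables A M Q : wfamily.
Hypotheses (sAC : subfam A C) (sMC : subfam M C).
Hypotheses (clQ : fam_closed Q).
Hypotheses (MA : subfam (gbr M A) M) (QA : subfam (gbr Q A) Q).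
Hypothesis MA' : subfam (gbr M (gbr A A)) Q.

Definition in_fam (fs : seq (F * V)) := forall f, List.In f fs -> A f.1 f.2.

Lemma brs_M x m fs : M x m -> in_fam fs -> M (x * \prod_(f <- fs) f.1) (brs m fs).
Proof.
elim: fs x m => [|f fs IH] x m Mm Afs /=; first by rewrite big_nil mulr1.
rewrite big_cons mulrA; apply: IH => [|h hfs]; last by apply: Afs; right.
by apply/MA/gbr_mem => //; apply: Afs; left.
Qed.

Lemma brs_Q x m fs : Q x m -> in_fam fs -> Q (x * \prod_(f <- fs) f.1) (brs m fs).
Proof.
elim: fs x m => [|f fs IH] x m Mm Afs /=; first by rewrite big_nil mulr1.
rewrite big_cons mulrA; apply: IH => [|h hfs]; last by apply: Afs; right.
by apply/QA/gbr_mem => //; apply: Afs; left.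
Qed.

Lemma brsB m m' fs : brs (m - m') fs = brs m fs - brs m' fs.
Proof. by elim: fs m m' => //= f fs IH m m'; rewrite brBl IH. Qed.

(** By the derivation rule, exchanging neighbours [f] and [h] costs a bracket of an element of [M]
    with [br f.2 h.2]. This lies in [Q] by [MA'], and the later operators preserve [Q]. *)
Lemma brs_perm fs fs' : Permutation fs fs' -> in_fam fs ->
  forall x m, M x m -> Q (x * \prod_(f <- fs) f.1) (brs m fs - brs m fs').
Proof.
elim=> {fs fs'} [|f fs fs' p IH|f h fs|fs fs' fs'' p1 IH1 p2 IH2] Afs x m Mm.
- by rewrite subrr; apply: (proj1 (clQ _)).
- rewrite big_cons mulrA /=; apply: IH => [k kfs|]; first by apply: Afs; right.
  by apply/MA/gbr_mem => //; apply: Afs; left.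
- rewrite !big_cons !mulrA /= -brsB.
  apply: brs_Q => [|k kfs]; last by apply: Afs; right; right.
  rewrite [br (br _ _) f.2]brJ addrAC subrr add0r -mulrA.
  apply: MA'; apply: gbr_mem => //.
  by apply: gbr_mem; apply: Afs; [left | right; left].
have E : \prod_(f <- fs) f.1 = \prod_(f <- fs') f.1.
  elim: p1 => {IH1 IH2 Afs p2 fs fs'} [|f fs fs' _ IH|f h fs|? ? ? _ -> _ ->] //.
    by rewrite !big_cons IH.
  by rewrite !big_cons mulrCA.
rewrite -(subrK (brs m fs') (brs m fs)) -addrA.
apply: sub_closedD => //; first exact: IH1.
by rewrite E; apply: IH2 => // f /(Permutation_in _ (Permutation_sym p1)); apply: Afs.
Qed.

Lemma brs_notin x m fs : M x m -> in_fam fs -> x * \prod_(f <- fs) f.1 \notin X ->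
  brs m fs = 0.
Proof. by move=> Mm Afs; apply: C_supp; apply/sMC/brs_M. Qed.

Lemma brs0 fs : brs 0 fs = 0.
Proof. by elim: fs => //= f fs; rewrite br0l. Qed.

(* Modulo Q the operators from A commute on M, so a product of d of them can be
   rearranged to leave the support. *)
Lemma brs_long x m fs : M x m -> in_fam fs -> size fs = d ->
  Q (x * \prod_(f <- fs) f.1) (brs m fs).
Proof.
move=> Mm Afs szfs.
have Q0 z : Q z 0 by case: (clQ z).
have [Xx|nXx] := boolP (x \in X); last first.
  by rewrite (C_supp (sMC Mm) nXx) brs0.
have [all_X|] := boolP (all (mem X) (map fst fs)); last first.
  case/allPn => y /mapP[f ffs ->{y}] nX.
  have f0 : f.2 = 0.
    by apply: C_supp nX; apply/sAC/Afs; move: ffs; elim: fs {Afs szfs} => //= h t IH;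
      rewrite inE => /predU1P[->|/IH]; [left|right].
  rewrite (_ : brs m fs = 0) //; elim: fs m {Mm szfs Afs} ffs => //= h t IH m.
  by rewrite inE => /predU1P[<-|/IH//]; rewrite f0 br0r brs0.
have [/allP sX|] := boolP (all (mem X) (subprods x (map fst fs))).
  (* If all subproducts stayed in [X], they would take more than [d] distinct values there. *)
  have := size_subprods Xx (allP all_X) sX; rewrite size_map szfs ltnNge.
  rewrite (leq_trans _ Xd) // uniq_leq_size ?undup_uniq // => z.
  by rewrite !mem_undup; apply: sX.
case/allPn => z /subprods_split[fs1 [fs2 [p ->]]] /= nX.
have Afs12 : in_fam (fs1 ++ fs2).
  by move=> f /(Permutation_in _ (Permutation_sym p)); apply: Afs.
have := brs_perm p Afs Mm.
(* The rearranged bracket is zero, because [fs1] already moves the weight out of [X]; only the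
   difference, which lies in [Q], remains. *)
rewrite [X in brs m fs - X](_ : _ = 0) ?subr0 //.
rewrite /brs foldl_cat -![foldl _ _ _]/(brs _ _) (brs_notin Mm _ nX) ?brs0 //.
by move=> f ffs1; apply: Afs12; apply: List.in_or_app; left.
Qed.

Fixpoint gbrn (k : nat) : wfamily :=
  if k is k'.+1 then gbr (gbrn k') A else M.

(** Reduces iterated brackets to left-normed monomials; the last operator is absorbed into the
    predicate [P']. *)
Lemma gbrn_min k (P : wfamily) : fam_closed P ->
  (forall x m fs, M x m -> in_fam fs -> size fs = k ->
     P (x * \prod_(f <- fs) f.1) (brs m fs)) -> subfam (gbrn k) P.
Proof.
elim: k P => [|k IH] P clP HP /=.
  by move=> x m Mm; have := HP x m [::] Mm; rewrite big_nil mulr1; apply.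
apply: gbr_min => // y z v w Mv Aw.
pose P' : wfamily := fun y v => P (y * z) (br v w).
have clP' : fam_closed P' by move=> ?; apply: closed_brl.
apply: (IH P' clP' _ _ _ Mv) => x m fs Mm Afs szfs; rewrite /P'.
have := HP x m (rcons fs (z, w)) Mm.
rewrite -cats1 big_cat big_seq1 /= mulrA /brs foldl_cat /=; apply.
  by move=> f /(@List.in_app_or _ _ _ _) [/Afs//|[<-|[]]].
by rewrite size_cat addn1 szfs.
Qed.

Lemma gbrn_sub : subfam (gbrn d) Q.
Proof. by apply: gbrn_min => // x m fs; apply: brs_long. Qed.

End Ideals.

Lemma glcs_sub A k : lie_closed A -> subfam (glcs A k) A.
Proof.
case=> clA brA; elim: k => //= k IH x v /(gbrS IH (fun _ _ h => h)); exact: brA.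
Qed.

Lemma glcsD A k j : glcs A (k + j) = gbrn A (glcs A k) j.
Proof. by elim: j => [|j IH]; rewrite ?addn0 // addnS /= IH. Qed.

Lemma gbrnS A M M' k : subfam M M' -> subfam (gbrn A M k) (gbrn A M' k).
Proof. by move=> sM; elim: k => //= k IH; apply: gbrS. Qed.

(** By [gbr_jacobi] the outer factor moves either into the previous term, where induction applies,
    or into [gbr A A], which absorbs it. *)
Lemma glcs_ideal A k : lie_closed A ->
  subfam (gbr (glcs (gbr A A) k) A) (glcs (gbr A A) k).
Proof.
move=> [clA brA]; elim: k => [|k IH] /=; first exact: gbrS.
apply: gbr_jacobi; first exact: gbr_closed.
  exact: gbrS.
by apply: gbrS => //; apply: gbrS.
Qed.

(** The geometric sum 1 + d + ... + d^(s-1). *)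
Fixpoint nilbound (s : nat) : nat := if s is s'.+1 then (nilbound s' * d).+1 else 0.

Lemma glcs_nilbound s A : lie_closed A -> subfam A C ->
  (forall x v, gder s A x v -> v = 0) -> forall x v, glcs A (nilbound s) x v -> v = 0.
Proof.
elim: s A => //= s IH A cA sAC gA0.
have cA' := lie_closed_gbr cA; have brA := cA.2.
have sA'C : subfam (gbr A A) C by move=> x v /brA /sAC.
have A'0 := IH _ cA' sA'C gA0.
(* The first bracket enters [gbr A A]; every [d] further ones go down one term of its lower central
   series. *)
have step i : subfam (glcs A (i * d).+1) (glcs (gbr A A) i).
  elim: i => [|i IHi]; first by [].
  have -> : (i.+1 * d).+1 = ((i * d).+1 + d)%N by lia.
  rewrite glcsD => x v /(gbrnS IHi).
  apply: gbrn_sub => //.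
  - by move=> y w /(glcs_sub cA') /sA'C.
  - exact: gbr_closed.
  - exact: glcs_ideal.
  - exact: (@glcs_ideal A i.+1).
by move=> x v /step; apply: A'0.
Qed.

Lemma glcs_eq0_leq A k j : (k <= j)%N -> (forall x v, glcs A k x v -> v = 0) ->
  forall x v, glcs A j x v -> v = 0.
Proof.
move=> /subnKC <- Ak0; elim: (j - k)%N => [|i IH]; first by rewrite addn0.
rewrite addnS /= => x v; apply: (@zspan_min _ _ (fun v => v = 0)).
  by split=> // ? ? -> ->; rewrite subr0.
by move=> _ [y [z [u [w [_ /IH -> _ ->]]]]]; rewrite br0l.
Qed.

Definition total_span (A : wfamily) := zspan (fun v => exists x, A x v).

Lemma total_span_br A B v w :
  total_span A v -> total_span B w -> total_span (gbr A B) (br v w).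
Proof.
elim=> {v} [v [x Av]||v1 v2 _ IH1 _ IH2] Bw.
- elim: Bw => {w} [w [y Bw]||w1 w2 _ IH1 _ IH2].
  + by apply: zspan_gen; exists (x * y); apply: gbr_mem.
  + by rewrite br0r; apply: zspan0.
  by rewrite brBr; apply: zspanB.
- by rewrite br0l; apply: zspan0.
by rewrite brBl; apply: zspanB; [apply: IH1 | apply: IH2].
Qed.

Lemma glcs_class x v : glcs C (nilbound (2 ^ size X).-1) x v -> v = 0.
Proof. by apply: glcs_nilbound => // y w; apply: gder_eq0. Qed.

End GradedLie.

(** For [d >= 2] the geometric sum with [s] terms is below [d ^ s]; the cases [d <= 1] are computed
    directly. *)
Lemma nilbound_leq d l : (l <= d)%N -> (nilbound d (2 ^ l).-1 <= d ^ (2 ^ d))%N.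
Proof.
case: d => [|[|d]]; first by case: l.
  by case: l => [|[]].
move=> led; apply: (@leq_trans (d.+2 ^ (2 ^ l).-1)).
  elim: (_.-1) => //= s IH; rewrite expnS.
  suff : (nilbound d.+2 s < d.+2 ^ s)%N by move: (d.+2 ^ s)%N => q; nia.
  elim: s {IH} => //= s IH; rewrite expnS; move: (d.+2 ^ s)%N IH => q; nia.
by rewrite leq_exp2l // (leq_trans (leq_pred _)) // leq_exp2l.
Qed.

(** * An order on the complex plane *)

Section PlaneOrder.
Variable R : realFieldType.
Implicit Types p q : R * R.

(* The classes are ordered by argument, except that positive reals of modulus at most 1
   come last: this is the lexicographic cyclic order on arguments and moduli, cut at 1. *)
Definition arg_class p : nat :=
  if p.2 == 0 then (if p.1 < 0 then 2 else if p.1 <= 1 then 4 else 0)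
  else if 0 < p.2 then 1 else 3.

Variant arg_class_spec p : nat -> Type :=
  | ArgClass0 of p.2 = 0 & 1 < p.1 : arg_class_spec p 0
  | ArgClass1 of 0 < p.2 : arg_class_spec p 1
  | ArgClass2 of p.2 = 0 & p.1 < 0 : arg_class_spec p 2
  | ArgClass3 of p.2 < 0 : arg_class_spec p 3
  | ArgClass4 of p.2 = 0 & 0 <= p.1 & p.1 <= 1 : arg_class_spec p 4.

Lemma arg_classP p : arg_class_spec p (arg_class p).
Proof.
rewrite /arg_class; case: eqP => [p2|/eqP p2].
  case: ltP => p1; first by constructor.
  by case: leP => p1'; constructor.
by case: ltP => // p2'; constructor => //; rewrite lt_neqAle p2.
Qed.

Definition sqnorm p := p.1 ^+ 2 + p.2 ^+ 2.
Definition cross p q := p.1 * q.2 - p.2 * q.1.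
Definition cmul p q := (p.1 * q.1 - p.2 * q.2, p.1 * q.2 + p.2 * q.1).

(** Inside a class arguments differ by less than pi, so the sign of [cross] compares them, and
    [sqnorm] breaks ties. *)
Definition arg_le p q :=
  (arg_class p < arg_class q)%N || (arg_class p == arg_class q) &&
  ((0 < cross p q) || (cross p q == 0) && (sqnorm p <= sqnorm q)).

Lemma arg_leE p q : arg_le p q ->
  (arg_class p < arg_class q)%N \/ arg_class p = arg_class q /\
  (0 < cross p q \/ cross p q = 0 /\ sqnorm p <= sqnorm q).
Proof.
case/orP=> [|/andP[/eqP E /orP[H|/andP[/eqP H1 H2]]]]; first by left.
  by right; split=> //; left.
by right; split=> //; right.
Qed.

Lemma arg_le_total : total arg_le.
Proof.
move=> p q; rewrite /arg_le; case: ltngtP => //= _.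
have -> : cross q p = - cross p q by rewrite /cross; ring.
rewrite oppr_gt0 oppr_eq0; case: ltgtP => //= _; exact: le_total.
Qed.

Lemma arg_le_trans : transitive arg_le.
Proof.
move=> q p r /arg_leE H1 /arg_leE H2; rewrite /arg_le.
case: H1 => [lt1|[eq1 H1]]; case: H2 => [lt2|[eq2 H2]].
- by rewrite (ltn_trans lt1 lt2).
- by rewrite -eq2 lt1.
- by rewrite eq1 lt2.
rewrite eq1 eq2 ltnn eqxx /=.
(* In the classes 1 and 3 the second coordinates share a sign, so this identity passes the sign of
   [cross] along. *)
have key : q.2 * cross p r = r.2 * cross p q + p.2 * cross q r.
  by rewrite /cross; ring.
have real_case : p.2 = 0 -> q.2 = 0 -> r.2 = 0 ->
    (0 < cross p r) || (cross p r == 0) && (sqnorm p <= sqnorm r).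
  move=> p2 q2 r2; move: H1 H2; rewrite /cross p2 q2 r2 !mulr0 !mul0r subrr ltxx eqxx.
  by case=> [//|[_ H1]] [//|[_ H2]]; apply: le_trans H2.
move: eq1 eq2.
case: (arg_classP p) => p2; case: (arg_classP q) => q2 //; case: (arg_classP r) => r2 //.
all: move=> *; try exact: real_case.
all: case: H1 => [H1|[H1 n1]]; case: H2 => [H2|[H2 n2]].
all: try (apply/orP; left; nra).
all: apply/orP; right; apply/andP; split; last by apply: le_trans n2.
all: apply/eqP; move: key; rewrite H1 H2 !mulr0 addr0 => /eqP; rewrite mulf_eq0.
all: by case/orP=> /eqP // q0; move: q2; rewrite q0 ltxx.
Qed.

(* If arg p <= arg (p q) <= arg q with arguments in [0, 2 pi), the sum of the arguments
   does not wrap around, so p is a positive real and the moduli decide. *)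
Lemma arg_le_mid p q : p != (0, 0) -> q != (0, 0) -> p != (1, 0) -> q != (1, 0) ->
  arg_le p (cmul p q) -> arg_le (cmul p q) q -> False.
Proof.
case: p q => a b [c e]; rewrite !xpair_eqE /= => p0 q0 p1 q1 /arg_leE H1 /arg_leE H2.
move: H1 H2; rewrite /cross /sqnorm /=.
(* Both cross products collapse: comparing [p] with the product reads off the sign of [e], comparing
   the product with [q] that of [- b]. *)
have -> : a * (a * e + b * c) - b * (a * c - b * e) = (a ^+ 2 + b ^+ 2) * e by ring.
have -> : (a * c - b * e) * e - (a * e + b * c) * c = - ((c ^+ 2 + e ^+ 2) * b) by ring.
have -> : (a * c - b * e) ^+ 2 + (a * e + b * c) ^+ 2 =
   (a ^+ 2 + b ^+ 2) * (c ^+ 2 + e ^+ 2) by ring.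
have pos (u v : R) : ~~ ((u == 0) && (v == 0)) -> 0 < u ^+ 2 + v ^+ 2 :> R.
  move=> uv; have := sqr_ge0 u; have := sqr_ge0 v => h1 h2.
  rewrite lt_neqAle addr_ge0 // andbT eq_sym paddr_eq0 // !sqrf_eq0; exact: uv.
have := pos a b p0; have := pos c e q0 => n2 n1.
(* Real factors are decided by the moduli: [p] above 1 makes the product larger than [q], and [q]
   below 1 makes it smaller than [p]. *)
have big (u S : R) : 1 < u -> 0 < S -> u ^+ 2 * S <= S -> False.
  by move=> u1 S0; rewrite -[leRHS]mul1r ler_pM2r // leNgt exprn_egt1.
have small (u S : R) : 0 <= u -> u <= 1 -> u != 1 -> 0 < S -> S <= S * u ^+ 2 -> False.
  move=> u0 u1 nu1 S0; by rewrite -[leLHS]mulr1 ler_pM2l  // leNgt exprn_ilt1 // lt_neqAle nu1.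
have := arg_classP (a, b); have := arg_classP (c, e); have := arg_classP (cmul (a, b) (c, e)).
rewrite /cmul /=.
case=> /= [z2 z1|z2|z2 z1|z2|z2 z1 z3]; case=> /= [c2 c1|c2|c2 c1|c2|c2 c1 c3];
case=> /= [b2 b1|b2|b2 b1|b2|b2 b1 b3].
all: case=> [H1|[H1e H1]]; case=> [H2|[H2e H2]] => //; exfalso.
all: move: p1 q1; rewrite ?c2 ?b2 ?eqxx ?andbT ?andbF /= => p1 q1; subst.
all: rewrite ?(mulr0, mul0r, addr0, subr0, add0r, sub0r, expr0n, oppr0) /= in z2 H1 H2 n1 n2.
all: try (case: H1 => [H1|[H1 H1']]); try (case: H2 => [H2|[H2 H2']]).
all: try by [].
all: try (by apply: (big a) H2'); try (by apply: (small c) H1').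
all: try lra.
all: try (rewrite ?(mulr0, mul0r, addr0, subr0, add0r, sub0r, expr0n, oppr0) /= in z1; lra).
all: try nra.
(* The case left has [p] above the real axis, [q] below it and a negative product: the sum of the
   arguments lies strictly between pi and 3 pi, so it is not an odd multiple of pi. *)
have key : b * (a * c - b * e) = - ((a ^+ 2 + b ^+ 2) * e).
  transitivity (a * (a * e + b * c) - (a ^+ 2 + b ^+ 2) * e); first by ring.
  by rewrite z2 mulr0 sub0r.
have : 0 < b * (a * c - b * e) by rewrite key -mulrN mulr_gt0 // oppr_gt0.
by rewrite pmulr_rgt0 // ltNge ltW.
Qed.

End PlaneOrder.

Definition alg_plane (z : algC) : algR * algR :=
  (in_algR (Creal_Re z), in_algR (Creal_Im z)).

Lemma alg_planeM x y : alg_plane (x * y) = cmul (alg_plane x) (alg_plane y).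
Proof. by congr (_, _); apply: val_inj; rewrite /= ?ReM ?ImM // ['Re y * _]mulrC. Qed.

Lemma alg_plane_inj : injective alg_plane.
Proof. by move=> x y [Re_eq Im_eq]; rewrite [x]Crect [y]Crect Re_eq Im_eq. Qed.

Lemma alg_plane0 : alg_plane 0 = (0, 0).
Proof. by congr (_, _); apply: val_inj; rewrite /= raddf0. Qed.

Lemma alg_plane1 : alg_plane 1 = (1, 0).
Proof.
by congr (_, _); apply: val_inj; [apply/Creal_ReP | apply/Creal_ImP]; apply: rpred1.
Qed.

Lemma sorted_no_middle (X : seq algC) : 0 \notin X -> 1 \notin X ->
  no_middle (sort (relpre alg_plane (@arg_le _)) X).
Proof.
move=> X0 X1 R x Y z y defX Rz Yy zyx.
have tr : transitive (relpre alg_plane (@arg_le _)).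
  by move=> ? ? ?; apply: arg_le_trans.
have : sorted (relpre alg_plane (@arg_le _)) (sort (relpre alg_plane (@arg_le _)) X).
  by apply: sort_sorted => ? ?; apply: arg_le_total.
have Xz : z \in X by rewrite -(mem_sort (relpre alg_plane (@arg_le _))) defX mem_cat Rz.
have Xy : y \in X.
  by rewrite -(mem_sort (relpre alg_plane (@arg_le _))) defX mem_cat inE Yy !orbT.
rewrite defX (sorted_pairwise tr) pairwise_cat allrel_consr pairwise_cons.
case/and3P=> /andP[/allP/(_ z Rz) lezx _] _ /andP[/allP/(_ y Yy) lexy _].
have neq u v : u \in X -> v \notin X -> alg_plane u != alg_plane v.
  by move=> Xu Xv; rewrite (inj_eq alg_plane_inj); apply: contraNneq Xv => <-.
apply: (@arg_le_mid _ (alg_plane z) (alg_plane y)).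
- by rewrite -alg_plane0 neq.
- by rewrite -alg_plane0 neq.
- by rewrite -alg_plane1 neq.
- by rewrite -alg_plane1 neq.
- by rewrite -alg_planeM zyx.
by rewrite -alg_planeM zyx.
Qed.

(** * Progressions of roots *)

(** The bound [size r] overshoots the true size, harmlessly, since coefficients default to 0. *)
Definition decimate (R : nzRingType) (r : {poly R}) (p k : nat) : {poly R} :=
  \poly_(i < size r) r`_(i * p + k).

Lemma decimateE (R : comNzRingType) (r : {poly R}) p : (0 < p)%N ->
  r = \sum_(k < p) 'X^k * (decimate r p k \Po 'X^p).
Proof.
move=> p0; apply/polyP => i; rewrite coef_sum.
have ltp : (i %% p < p)%N by rewrite ltn_mod.
rewrite (bigD1 (Ordinal ltp)) //= big1 ?addr0 => [|k /eqP nk].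
  rewrite coefXnM ltnNge leq_mod /= coef_comp_poly_Xn //.
  have -> : (i - i %% p = i %/ p * p)%N by rewrite {1}(divn_eq i p) addnK.
  rewrite dvdn_mull // mulnK // coef_poly -divn_eq; case: ltnP => // le.
  by rewrite nth_default // (leq_trans le) // leq_div.
rewrite coefXnM; case: ltnP => // leki; rewrite coef_comp_poly_Xn //.
case: ifP => // /dvdnP[q Dq]; case: nk; apply: val_inj => /=.
by rewrite -(subnK leki) Dq modnMDl modn_small.
Qed.

(** [s] is the primitive integer multiple of the minimal polynomial; by Gauss's lemma a rational
    multiple of it with integer coefficients is an integral multiple. *)
Lemma intpoly_minimal (z : algC) : exists s : {poly int}, (1 < size s)%N /\
  forall q : {poly int}, root (rC q) z -> exists w, q = w * s.
Proof.
have [p [Dp mon_p] root_p] := minCpolyP z.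
have [s0 [a nza Ds0]] := rat_poly_scale p.
have szs : size s0 = size p.
  rewrite Ds0 size_scale ?invr_eq0 ?intr_eq0 //.
  by rewrite size_map_inj_poly //; apply: intr_inj.
exists (zprimitive s0); split.
  rewrite size_zprimitive szs -(size_map_poly (ratr : {rmorphism rat -> algC}) p) -Dp.
  exact: size_minCpoly.
move=> q qz.
have : p %| map_poly intr q.
  rewrite -root_p -map_poly_comp (eq_map_poly (_ : _ =1 intr)) //.
  by move=> c /=; rewrite ratr_int.
rewrite Ds0 dvdpZl ?invr_eq0 ?intr_eq0 // dvdp_rat_int => /dvdpP_int[w ->].
by exists w; rewrite mulrC.
Qed.

(** If 0 or 1 is a root, the scalar r(0) r(1) annihilates [r], and ['X \Po 'X^2] divides 0. *)
Lemma good_nonroot r : good_poly r -> r.[0] != 0 /\ r.[1] != 0.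
Proof.
move=> gr; apply/andP; rewrite -negb_or -mulf_eq0.
apply/negP => /eqP H; apply: gr; exists 1%N, 'X; rewrite size_polyX; split=> //.
by split=> //; exists 0; rewrite H scale0r mul0r.
Qed.

Lemma rC_int r (c : int) : (rC r).[c%:~R] = (r.[c])%:~R.
Proof. by rewrite /rC horner_map. Qed.

Lemma size_rC r : size (rC r) = size r.
Proof. by rewrite /rC size_map_inj_poly //; apply: intr_inj. Qed.

Lemma rC_eq0 r : (rC r == 0) = (r == 0).
Proof. by rewrite -!size_poly_eq0 size_rC. Qed.

(* A progression x, xy, xy^2, ... of roots forces y to be a root of unity, say of
   order p; then each of the p decimations of r vanishes at x^p. *)
Lemma good_arith_free r x y : good_poly r -> root (rC r) x -> root (rC r) y ->
  exists n, ~~ root (rC r) (x * y ^+ n).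
Proof.
move=> gr rx ry; have [r0 r1] := good_nonroot gr.
have nzr : r != 0 by apply: contraNneq r0 => ->; rewrite horner0.
have nz z : root (rC r) z -> z != 0.
  by apply: contraTneq => ->; rewrite /root -[0]/(0%:~R) rC_int intr_eq0.
have n1 z : root (rC r) z -> z != 1.
  by apply: contraTneq => ->; rewrite /root -[1]/(1%:~R) rC_int intr_eq0.
have [/existsP[i Hi]|/existsPn Hr] :=
  boolP [exists i : 'I_(size r), ~~ root (rC r) (x * y ^+ i)]; first by exists i.
(* [size r] exceeds the number of roots, so the progression repeats itself and [y] is a root of
   unity. *)
exfalso; pose rs := [seq x * y ^+ i | i <- iota 0 (size r)].
have rootrs i : (i < size r)%N -> root (rC r) (x * y ^+ i).
  by move=> lti; have := Hr (Ordinal lti); rewrite negbK.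
have : ~~ uniq rs.
  apply/negP => /(@max_poly_roots _ (rC r) rs); rewrite rC_eq0 size_rC size_map size_iota ltnn.
  suff -> : all (root (rC r)) rs by move/(_ nzr isT).
  by apply/allP => _ /mapP[i /[!mem_iota]/andP[_ lti] ->]; apply: rootrs.
case/(uniqPn 0) => i [j [ltij]]; rewrite size_map size_iota => ltj eqij.
have lti := ltn_trans ltij ltj; move: eqij.
rewrite !(nth_map 0%N) ?size_iota // !nth_iota // !add0n => /(mulfI (nz x rx)) eqy.
have yij : y ^+ (j - i) = 1.
  by apply: (mulfI (expf_neq0 i (nz y ry))); rewrite -exprD subnKC ?mulr1 // ltnW.
have [|p prim_y dvdp] := prim_order_exists _ yij; first by rewrite subn_gt0.
have p0 := prim_order_gt0 prim_y.
have lepr : (p <= size r)%N.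
  by apply: leq_trans (dvdn_leq _ dvdp) _; rewrite ?subn_gt0 // (leq_trans (leq_subr _ _)) // ltnW.
have p_gt1 : (1 < p)%N.
  rewrite ltn_neqAle p0 andbT eq_sym; apply/eqP => p1.
  by have := prim_expr_order prim_y; rewrite p1 expr1 => /eqP; apply/negP/n1.
have dec_root (k : 'I_p) : root (rC (decimate r p k)) (x ^+ p).
  (* As [(x * y ^+ j) ^+ p = x ^+ p], the value of [r] at [x * y ^+ j] is that of [Q] at [y ^+ j].
     So [Q], of degree below [p], has [p] distinct roots. *)
  pose Q := \poly_(k < p) ((rC (decimate r p k)).[x ^+ p] * x ^+ k).
  have Q0 : Q = 0.
    apply/eqP; apply/negPn/negP => nzQ.
    pose ys := [seq y ^+ i | i <- iota 0 p].
    have := @max_poly_roots _ Q ys nzQ; rewrite size_map size_iota.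
    have -> : uniq ys.
      rewrite map_inj_in_uniq ?iota_uniq // => a b; rewrite !mem_iota !add0n /= => lta ltb.
      by move/eqP; rewrite (eq_prim_root_expr prim_y) !modn_small // => /eqP.
    suff -> : all (root Q) ys by move=> /(_ isT isT); rewrite ltnNge size_poly.
    apply/allP => _ /mapP[j' /[!(mem_iota, add0n)]/andP[_ ltj'] ->].
    have := rootrs _ (leq_trans ltj' lepr); rewrite /root => /eqP.
    rewrite {1}(decimateE r p0) /rC rmorph_sum /= horner_sum => E.
    rewrite horner_poly -[X in _ == X]E; apply/eqP/eq_bigr => k' _.
    rewrite rmorphM /= map_comp_poly !map_polyXn hornerM horner_comp !hornerXn.
    have -> : (x * y ^+ j') ^+ p = x ^+ p.
      by rewrite exprMn exprAC (prim_expr_order prim_y) expr1n mulr1.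
    by rewrite exprMn -mulrA mulrC.
  have := congr1 (fun q : {poly algC} => q`_k) Q0; rewrite coef_poly ltn_ord coef0.
  by move/eqP; rewrite mulf_eq0 expf_eq0 (negPf (nz x rx)) andbF orbF.
have [s [szs sdvd]] := intpoly_minimal (x ^+ p).
(* Since [y != 1], the order [p] exceeds 1 and [p.-1] is admissible; [s] divides every decimation,
   hence [s \Po 'X^p] divides [r]. *)
apply: gr; exists p.-1, s; split; first by rewrite -subn1 subn_gt0.
rewrite prednK //; split=> //.
have /fin_all_exists[w Dw] : forall k : 'I_p, exists w, decimate r p k = w * s.
  by move=> k; apply/sdvd/dec_root.
exists ((r.[0] * r.[1]) *: \sum_(k < p) 'X^k * (w k \Po 'X^p)).
rewrite -scalerAl mulr_suml {3}(decimateE r p0); congr (_ *: _).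
by apply: eq_bigr => k _; rewrite Dw comp_polyM mulrA.
Qed.

(** * The torsion number *)

Lemma algC_conjugate_aut (x y : algC) : root (minCpoly x) y ->
  exists nu : {rmorphism algC -> algC}, nu x = y.
Proof.
move=> pxy; have [p [Dp mon_p] root_p] := minCpolyP x.
have [rs Drs] := closed_field_poly_normal (minCpoly x).
rewrite (monicP (minCpoly_monic x)) scale1r in Drs.
have [Qs [QsC [s1 Ds1 genQs]]] := num_field_exists rs.
have preim z : root (minCpoly x) z -> exists z1, QsC z1 = z.
  by rewrite Drs root_prod_XsubC -Ds1 => /mapP[z1 _ ->]; exists z1.
have [x1 Dx] := preim x (root_minCpoly x); have [y1 Dy] := preim y pxy.
have homQ : kHom 1 1 (\1%VF : 'End(Qs)) by rewrite kHom1.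
have rooty : root (map_poly \1%VF (minPoly 1 x1)) y1.
  rewrite -(fmorph_root QsC) Dy -map_poly_comp.
  rewrite (@eq_map_poly _ _ _ QsC) => [|b]; last by rewrite /= id_lfunE.
  have [q Dq] : exists q, map_poly QsC (minPoly 1 x1) = map_poly ratr q.
    have aP i : (minPoly 1 x1)`_i \in 1%VS by apply/polyOverP; apply: minPolyOver.
    have{aP} a_ i := sig_eqW (vlineP _ _ (aP i)).
    exists (\poly_(i < size (minPoly 1 x1)) sval (a_ i)).
    apply/polyP=> i; rewrite coef_poly coef_map coef_poly /=.
    case: ifP => _; rewrite ?rmorph0 //; case: (a_ i) => b /= ->.
    by rewrite alg_num_field fmorph_rat.
  have : root (map_poly QsC (minPoly 1 x1)) x by rewrite -Dx fmorph_root root_minPoly.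
  rewrite Dq root_p => /dvdpP[q' ->]; by rewrite rmorphM rootM /= -Dp pxy orbT.
(* Sending [x1] to [y1] embeds the field generated by [x1]; the embedding extends to the splitting
   field [Qs], then to [algC]. *)
pose f := kHomExtend 1 \1 x1 y1.
have homf : kHom 1 <<1; x1>> f by apply: kHomExtendP.
pose pr := map_poly (in_alg Qs) p.
have Qpr : pr \is a polyOver 1%VS.
  by apply/polyOverP=> i; rewrite coef_map memvZ ?memv_line.
have splitQs : splittingFieldFor <<1; x1>> pr fullv.
  apply: splittingFieldForS (sub1v _) (subvf _) _; exists s1 => //.
  congr (_ %= _): (eqpxx pr); apply/(map_poly_inj QsC).
  rewrite -map_poly_comp (eq_map_poly (_ : _ =1 ratr)).
    rewrite -Dp Drs -Ds1 big_map rmorph_prod /=; apply: eq_bigr => zz _.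
    by rewrite map_polyXsubC.
  by move=> b /=; rewrite alg_num_field fmorph_rat.
have [f1 aut_f1 Df1] := kHom_extends (sub1v _) homf Qpr splitQs.
pose f1mM := GRing.isMonoidMorphism.Build _ _ f1 (kHom_monoid_morphism aut_f1).
pose phi : {rmorphism Qs -> Qs} := HB.pack (fun_of_lfun f1) f1mM.
have [nu Dnu] := extend_algC_subfield_aut QsC phi.
exists nu; rewrite -Dx -Dnu /= -Dy -Df1 ?memv_adjoin //.
by rewrite (kHomExtend_val homQ).
Qed.

(** Every root of the minimal polynomial is conjugate to [x], hence equal to it; so the sum of the
    roots, a rational number, is a positive multiple of [x]. *)
Lemma aut_fixed_Crat (x : algC) :
  (forall nu : {rmorphism algC -> algC}, nu x = x) -> x \in Crat.
Proof.
move=> fixx; have [p [Dp mon_p] root_p] := minCpolyP x.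
have [rs Drs] := closed_field_poly_normal (minCpoly x).
rewrite (monicP (minCpoly_monic x)) scale1r in Drs.
have rs_x y : y \in rs -> y = x.
  by rewrite -root_prod_XsubC -Drs => /algC_conjugate_aut[nu <-].
have szrs : size rs != 0%N.
  have := size_minCpoly x; rewrite Drs size_prod_XsubC; by case: (size rs).
have := coefPn_prod_XsubC szrs; rewrite -Drs Dp coef_map /=.
rewrite (eq_big_seq (fun=> x)) // big_const_seq count_predT iter_addr addr0.
move/(congr1 -%R); rewrite opprK -rmorphN -mulr_natr => Dx.
have nzn : (size rs)%:R != 0 :> algC by rewrite pnatr_eq0.
by rewrite -(mulfK nzn x) -Dx rpred_div ?rpred_nat ?Crat_rat.
Qed.

Lemma rC_factor r :
  rC r = (lead_coef r)%:~R *: \prod_(z <- roots_mult r) ('X - z%:P).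
Proof.
have := svalP (closed_field_poly_normal (rC r)).
by rewrite -/(roots_mult r) lead_coef_map_inj //; apply: intr_inj.
Qed.

Lemma size_roots_mult r : r != 0 -> size (roots_mult r) = (size r).-1.
Proof.
move=> nzr; have := congr1 (fun p : {poly algC} => size p) (rC_factor r).
by rewrite size_rC size_scale ?intr_eq0 ?lead_coef_eq0 // size_prod_XsubC => ->.
Qed.

Lemma mem_droots r x : r != 0 -> (x \in droots r) = root (rC r) x.
Proof.
move=> nzr; rewrite /droots mem_undup rC_factor.
by rewrite rootZ ?intr_eq0 ?lead_coef_eq0 // root_prod_XsubC.
Qed.

Lemma prod_mull (c : algC) (s : seq algC) :
  c ^+ size s * \prod_(u <- s) u = \prod_(u <- s) (c * u).
Proof. by elim: s => [|u s IH]; rewrite ?big_nil ?mulr1 // !big_cons -IH exprS mulrACA. Qed.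

Lemma scaled_prod_dvd (S : subringClosed algC) (c : algC) (s : seq algC) u :
  {in s, forall v, c * v \in S} -> u \in s ->
  exists2 q, q \in S & c ^+ size s * \prod_(v <- s) v = q * (c * u).
Proof.
move=> sS su; rewrite prod_mull; exists (\prod_(v <- rem u s) (c * v)).
  by rewrite big_seq rpred_prod // => v /mem_rem /sS.
by rewrite (perm_big _ (perm_to_rem su)) big_cons [LHS]mulrC.
Qed.

(** Among the entries other than [x], each remaining distinct value still occurs. *)
Lemma count_undup (T : eqType) (s : seq T) x : x \in s ->
  (count_mem x s + size (undup s) <= (size s).+1)%N.
Proof.
move=> sx; rewrite -[X in (_ <= X.+1)%N](count_predC (pred1 x) s) -addnS leq_add2l.
have ux : x \in undup s by rewrite mem_undup.
have -> : size (undup s) = (size (rem x (undup s))).+1.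
  by rewrite size_rem // prednK //; case: (undup s) ux.
rewrite ltnS -size_filter uniq_leq_size ?rem_uniq ?undup_uniq // => y.
by rewrite mem_rem_uniq ?undup_uniq // !inE mem_filter /= mem_undup.
Qed.

Definition root_diffs (r : {poly int}) : seq algC :=
  [seq i - j | i <- droots r, j <- [seq j <- droots r | i != j]].
Definition root_vals (r : {poly int}) : seq algC :=
  [seq (rC r).[i * j] | i <- droots r, j <- [seq j <- droots r | (rC r).[i * j] != 0]].

Lemma prod_root_diffs r m :
  \prod_(i <- droots r) \prod_(j <- droots r | i != j) (i - j) ^+ m =
  (\prod_(u <- root_diffs r) u) ^+ m.
Proof.
rewrite big_allpairs_dep -prodrXl; apply: eq_bigr => i _.
by rewrite big_filter prodrXl.
Qed.

Lemma prod_root_vals r :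
  \prod_(i <- droots r) \prod_(j <- droots r | (rC r).[i * j] != 0) (rC r).[i * j] =
  \prod_(u <- root_vals r) u.
Proof. by rewrite big_allpairs_dep; apply: eq_bigr => i _; rewrite big_filter. Qed.

Lemma size_root_diffs r :
  size (root_diffs r) = (size (droots r) * (size (droots r)).-1)%N.
Proof.
rewrite size_allpairs_dep; set s := droots r.
have us : uniq s by apply: undup_uniq.
transitivity (sumn [seq (size s).-1 | i <- s]); last first.
  by elim: {us}s (_.-1) => //= i t IH n; rewrite IH mulSn.
congr sumn; apply/eq_in_map => i si; rewrite size_filter.
have := count_predC (pred1 i) s; rewrite count_uniq_mem // si => <-.
by rewrite add1n /=; apply: eq_count => j; rewrite /= eq_sym.
Qed.

Lemma size_root_vals r : (size (root_vals r) <= size (droots r) ^ 2)%N.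
Proof.
rewrite size_allpairs_dep; set s := droots r.
have: forall t : seq algC, (sumn [seq size [seq j <- s | ((rC r).[i * j] != 0)%R] | i <- t]
  <= size t * size s)%N.
  by elim=> //= i t IH; rewrite mulSn leq_add // size_filter count_size.
by move/(_ s); rewrite -mulnn.
Qed.

(** With [d] the degree, [l] the number of distinct roots and [m] the largest multiplicity, the left
    side bounds the factors [a] that make the differences and the values of [r] integral. The right
    side is the supply, apart from one spare [a]. *)
Lemma torsion_exponent_bound (d l m : nat) : (0 < m)%N -> (l + m <= d.+1)%N ->
  (m * (l * l.-1) + 2 * d * l ^ 2 <= 2 * d ^ 2 + 2 * d ^ 3)%N.
Proof.
case: m => // m _; rewrite addnS ltnS => ld.
have h1 : (m.+1 * (l * l.-1) <= l * l + m * (l * l))%N.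
  by rewrite -mulSn leq_mul2l leq_mul2l leq_pred !orbT.
have h2 : (l * l + m * l <= d * d)%N by nia.
have h3 : (d * (l * l + m * l) <= d * (d * d))%N by rewrite leq_mul2l h2 orbT.
have h4 : (m * (l * l) <= d * (m * l))%N by nia.
rewrite !expnS !expn0 !muln1; nia.
Qed.

Section TorsionNumber.

Variable r : {poly int}.
Hypothesis szr : (1 < size r)%N.
Let d := (size r).-1.
Let a : algC := (lead_coef r)%:~R.

Let nzr : r != 0. Proof. by rewrite -size_poly_gt0 ltnW. Qed.

Lemma droots_gt0 : (0 < size (droots r))%N.
Proof.
rewrite /droots lt0n size_eq0; apply/eqP => /undup_nil /(congr1 size) /=.
by rewrite size_roots_mult //; case: (size r) szr => [|[]].
Qed.

Lemma maxmult_bound : (size (droots r) + maxmult r <= d.+1)%N.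
Proof.
have sub x : x \in droots r -> (count_mem x (roots_mult r) <= d.+1 - size (droots r))%N.
  rewrite /droots mem_undup => /count_undup; rewrite size_roots_mult // -/d => H.
  by rewrite leq_subRL ?[(size _ + _)%N]addnC // (leq_trans _ H) // leq_addl.
have led : (size (droots r) <= d.+1)%N.
  by rewrite (leq_trans (size_undup _)) // size_roots_mult // -/d leqnSn.
rewrite -(subnKC led) leq_add2l /maxmult; apply/bigmax_leqP_seq => x xs _; exact: sub.
Qed.

Lemma maxmult_gt0 : (0 < maxmult r)%N.
Proof.
have [x xr] : exists x, x \in droots r.
  by case: (droots r) droots_gt0 => // x s _; exists x; rewrite mem_head.
apply: leq_trans (leq_bigmax_seq _ xr isT).
by rewrite -has_count has_pred1 -mem_undup.
Qed.

(* The powers of the leading coefficient suffice to clear all denominators. *)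
Lemma torsion_factor : exists e : nat, Discr_star r * Prod_star r =
  a * a ^+ e * ((maxmult r).-1`!)%:R *
  (a ^+ size (root_diffs r) * \prod_(u <- root_diffs r) u) ^+ maxmult r *
  ((a ^+ (2 * d)) ^+ size (root_vals r) * \prod_(u <- root_vals r) u).
Proof.
set A := size (root_diffs r); set B := size (root_vals r); set m := maxmult r.
have le : (A * m + 2 * d * B <= 2 * d ^ 2 + 2 * d ^ 3)%N.
  apply: leq_trans (torsion_exponent_bound maxmult_gt0 maxmult_bound).
  by rewrite leq_add ?leq_mul2l ?size_root_vals ?orbT // /A size_root_diffs mulnC.
(* The surplus of factors [a]; by [le] the subtraction does not truncate. *)
exists (2 * d ^ 2 + 2 * d ^ 3 - (A * m + 2 * d * B))%N.
rewrite /Discr_star /Prod_star leqNgt szr /= -/d -/a -/m.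
rewrite prod_root_diffs prod_root_vals exprMn -!exprM -exprS.
set x := _%:R; set y := _ ^+ m; set z := \prod_(u <- _) u.
transitivity (a ^+ (1 + 2 * d ^ 2 + 2 * d ^ 3) * (x * y * z)).
  by rewrite !exprD; move: (a ^+ 1) (a ^+ (2 * d ^ 2)) (a ^+ (2 * d ^ 3)) => u v w; ring.
set e := (_ - _)%N.
have -> : (1 + 2 * d ^ 2 + 2 * d ^ 3 = e.+1 + A * m + 2 * d * B)%N by rewrite /e; lia.
by rewrite !exprD; move: (a ^+ e.+1) (a ^+ (A * m)) (a ^+ (2 * d * B)) => u v w; ring.
Qed.

Variable S : subringClosed algC.
Hypothesis S_roots : {in droots r, forall x, a * x \in S}.

Let Sa : a \in S. Proof. exact: rpred_int. Qed.

Lemma scaled_diff_mem : {in root_diffs r, forall u, a * u \in S}.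
Proof.
move=> _ /allpairsPdep[i [j [ir /[!mem_filter]/andP[_ jr] ->]]].
by rewrite mulrBr rpredB ?S_roots.
Qed.

(** Each [(i * j) ^+ k] with [k <= d] absorbs [a ^+ (2 * k)], one [a] for every root in it. *)
Lemma scaled_val_mem i j : i \in droots r -> j \in droots r ->
  a ^+ (2 * d) * (rC r).[i * j] \in S.
Proof.
move=> ir jr; rewrite horner_coef size_rC mulr_sumr rpred_sum // => k _.
have le : (k <= d)%N by rewrite -ltnS /d prednK // ltnW.
have -> : (2 * d = 2 * k + 2 * (d - k))%N by lia.
rewrite exprD coef_map /= exprM.
have -> : a ^+ 2 ^+ k * a ^+ (2 * (d - k)) * ((r`_k)%:~R * (i * j) ^+ k) =
   ((a * i) * (a * j)) ^+ k * a ^+ (2 * (d - k)) * (r`_k)%:~R.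
  rewrite [(a * i) * _]mulrACA -expr2 [(a ^+ 2 * (i * j)) ^+ k]exprMn.
  by move: (a ^+ 2 ^+ k) (a ^+ (2 * (d - k))) ((i * j) ^+ k) => u v w; ring.
have Sij := rpredM (S_roots ir) (S_roots jr).
by rewrite rpredM ?rpred_int // rpredM ?rpredX.
Qed.

Lemma scaled_vals_mem : {in root_vals r, forall u, a ^+ (2 * d) * u \in S}.
Proof.
move=> _ /allpairsPdep[i [j [ir /[!mem_filter]/andP[_ jr] ->]]].
exact: scaled_val_mem.
Qed.

Lemma scaled_prod_mem c s : {in s, forall u, c * u \in S} ->
  c ^+ size s * \prod_(u <- s) u \in S.
Proof. by move=> sS; rewrite prod_mull big_seq rpred_prod. Qed.

Let N := Discr_star r * Prod_star r.

Let Sdiffs := scaled_prod_mem scaled_diff_mem.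
Let Svals := scaled_prod_mem scaled_vals_mem.

Lemma torsion_dvd_lead : exists2 q, q \in S & N = q * a.
Proof.
rewrite /N; have [e ->] := torsion_factor; move: Sdiffs Svals.
set y := a ^+ size _ * _; set z := a ^+ _ ^+ _ * _; set x := _%:R => Sy Sz.
have Sx : x \in S by apply: rpred_nat.
clearbody x y z; exists (a ^+ e * x * y ^+ maxmult r * z); last by ring.
by rewrite !rpredM ?rpredX.
Qed.

Lemma torsion_mem : N \in S.
Proof. by have [q Sq ->] := torsion_dvd_lead; rewrite rpredM. Qed.

Lemma torsion_dvd_diff i j : i \in droots r -> j \in droots r -> i != j ->
  exists2 q, q \in S & N = q * (a * (i - j)).
Proof.
move=> ir jr nij; have [e DN] := torsion_factor.
have dij : i - j \in root_diffs r.
  by apply/allpairsPdep; exists i, j; rewrite mem_filter nij.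
have [q Sq Dq] := scaled_prod_dvd scaled_diff_mem dij.
move: DN Dq Sdiffs Svals; rewrite -(prednK maxmult_gt0) exprSr /=.
set y := a ^+ size _ * _; set z := a ^+ _ ^+ _ * _; move: (_.-1) => m DN Dq Sy Sz.
clearbody y z; exists (a * a ^+ e * (m`!)%:R * (y ^+ m * q) * z).
  by rewrite !rpredM ?rpredX ?rpred_nat.
by rewrite /N DN Dq; ring.
Qed.

Lemma torsion_dvd_val i j : i \in droots r -> j \in droots r -> (rC r).[i * j] != 0 ->
  exists2 q, q \in S & N = q * (a ^+ (2 * d) * (rC r).[i * j]).
Proof.
move=> ir jr nij; have [e DN] := torsion_factor.
have dij : (rC r).[i * j] \in root_vals r.
  by apply/allpairsPdep; exists i, j; rewrite mem_filter nij.
have [q Sq Dq] := scaled_prod_dvd scaled_vals_mem dij.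
move: DN Sdiffs; rewrite Dq; set x := _%:R; set y := a ^+ size _ * _ => DN Sy.
have Sx : x \in S by apply: rpred_nat.
clearbody x y; exists (a * a ^+ e * x * y ^+ maxmult r * q); last by rewrite /N DN; ring.
by rewrite !rpredM ?rpredX ?rpred_nat.
Qed.

End TorsionNumber.

(** * Integrality of the scaled roots and of the torsion number *)

Lemma coef_comp_scaleX (R : comNzRingType) (p : {poly R}) c k :
  (p \Po (c *: 'X))`_k = c ^+ k * p`_k.
Proof.
rewrite comp_polyE (eq_bigr (fun i : 'I_(size p) => (c ^+ i * p`_i) *: 'X^i)); last first.
  by move=> i _; rewrite exprZn scalerA mulrC.
rewrite -(poly_def (size p) (fun i => c ^+ i * p`_i)) coef_poly.
by case: ltnP => // le; rewrite nth_default ?mulr0.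
Qed.

(** With [a] the leading coefficient and [d] the degree, this is the monic polynomial a^(d-1)
    r(X/a). *)
Definition scaled_poly (r : {poly int}) : {poly algC} :=
  \prod_(z <- roots_mult r) ('X - ((lead_coef r)%:~R * z)%:P).

Lemma scaled_polyE r k : r != 0 ->
  (lead_coef r)%:~R * (lead_coef r)%:~R ^+ k * (scaled_poly r)`_k =
  (lead_coef r)%:~R ^+ (size r).-1 * (r`_k)%:~R.
Proof.
move=> nzr; set a : algC := (lead_coef r)%:~R.
have E : a *: (scaled_poly r \Po (a *: 'X)) = a ^+ (size r).-1 *: rC r.
  rewrite rC_factor -/a -size_roots_mult // [RHS]scalerA mulrC -scalerA; congr (_ *: _).
  rewrite /scaled_poly rmorph_prod /=.
  elim: (roots_mult r) => [|z s IH]; first by rewrite !big_nil scale1r.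
  rewrite !big_cons IH /= exprS.
  have -> : ('X - (a * z)%:P) \Po (a *: 'X) = a *: ('X - z%:P).
    by rewrite comp_polyB comp_polyX comp_polyC scalerBr polyCM mul_polyC.
  by rewrite -scalerAl -scalerAr scalerA.
have := congr1 (fun p : {poly algC} => p`_k) E; rewrite !coefZ coef_map /= => <-.
by rewrite -mulrA; congr (_ * _); rewrite coef_comp_scaleX.
Qed.

Lemma scaled_poly_int r k : r != 0 -> (scaled_poly r)`_k \in Num.int.
Proof.
move=> nzr; have := scaled_polyE k nzr; set a : algC := (lead_coef r)%:~R.
have nza : a != 0 by rewrite intr_eq0 lead_coef_eq0.
have sz : size (scaled_poly r) = size r.
  have := size_prod_XsubC [seq a * z | z <- roots_mult r] id.
  rewrite big_map size_map size_roots_mult // => ->.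
  by rewrite prednK // size_poly_gt0.
have [ltk|gek] := ltnP k (size r).-1; last first.
  move=> _; have [E|] := ltnP k (size r); last by move=> le; rewrite nth_default ?sz ?rpred0.
  have -> : k = (size r).-1 by lia.
  rewrite -[X in _`_X.-1]sz -lead_coefE (monicP _) ?rpred1 //.
  exact: monic_prod_XsubC.
have -> : (size r).-1 = (k.+1 + ((size r).-1 - k.+1))%N by lia.
rewrite -exprS exprD -mulrA => /(mulfI (expf_neq0 _ nza)) ->.
by rewrite rpredM ?rpredX ?rpred_int ?intr_int.
Qed.

Lemma scaled_root_Aint r x : r != 0 -> x \in droots r ->
  (lead_coef r)%:~R * x \in Aint.
Proof.
move=> nzr; rewrite mem_undup => xr; apply: (@root_monic_Aint (scaled_poly r)).
- have -> : scaled_poly r =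
     \prod_(z <- [seq (lead_coef r)%:~R * z | z <- roots_mult r]) ('X - z%:P).
    by rewrite big_map.
  by rewrite root_prod_XsubC map_f.
- exact: monic_prod_XsubC.
by apply/polyOverP => k; apply: scaled_poly_int.
Qed.

Lemma rC_aut r (nu : {rmorphism algC -> algC}) : map_poly nu (rC r) = rC r.
Proof.
by rewrite /rC -map_poly_comp; apply: eq_map_poly => c /=; rewrite rmorph_int.
Qed.

Lemma droots_aut (r : {poly int}) (nu : {rmorphism algC -> algC}) : r != 0 ->
  perm_eq (map nu (droots r)) (droots r).
Proof.
move=> nzr; have us := undup_uniq (roots_mult r); rewrite -/(droots r) in us.
have umap : uniq (map nu (droots r)) by rewrite map_inj_uniq //; apply: fmorph_inj.
apply: uniq_perm => //; have [] := @uniq_min_size _ (map nu (droots r)) (droots r) => //.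
  move=> _ /mapP[x xr ->]; move: xr; rewrite !mem_droots //.
  by rewrite -(fmorph_root nu) rC_aut.
by rewrite size_map.
Qed.

(** An automorphism fixes [r] and permutes its distinct roots, so it only reindexes the products. *)
Lemma torsion_rat (r : {poly int}) : (1 < size r)%N -> Discr_star r * Prod_star r \in Crat.
Proof.
move=> szr; have nzr : r != 0 by rewrite -size_poly_gt0 ltnW.
apply: aut_fixed_Crat => nu; rewrite /Discr_star /Prod_star leqNgt szr /=.
have nurC x : nu (rC r).[x] = (rC r).[nu x] by rewrite -horner_map rC_aut.
rewrite !rmorphM /= !rmorphXn /= rmorph_nat !rmorph_int; congr (_ * _ * (_ * _)).
  rewrite rmorph_prod -[RHS](perm_big _ (droots_aut nu nzr)) /= big_map.
  apply: eq_bigr => i _; rewrite rmorph_prod -[RHS](perm_big _ (droots_aut nu nzr)) /= big_map.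
  apply: eq_big => [j|j _]; first by rewrite (inj_eq (fmorph_inj nu)).
  by rewrite rmorphXn rmorphB.
rewrite rmorph_prod -[RHS](perm_big _ (droots_aut nu nzr)) /= big_map.
apply: eq_bigr => i _; rewrite rmorph_prod -[RHS](perm_big _ (droots_aut nu nzr)) /= big_map.
apply: eq_big => [j|j _]; last by rewrite nurC rmorphM.
by rewrite -rmorphM -nurC fmorph_eq0.
Qed.

Lemma torsion_int (r : {poly int}) : (1 < size r)%N ->
  exists N : int, N%:~R = Discr_star r * Prod_star r.
Proof.
move=> szr; have nzr : r != 0 by rewrite -size_poly_gt0 ltnW.
have /intrP[N ->] : Discr_star r * Prod_star r \in Num.int; last by exists N.
apply: Cint_rat_Aint (torsion_rat szr) _.
(* Here [S] is the whole ring [Aint]. *)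
by apply: torsion_mem => // x; apply: scaled_root_Aint.
Qed.

(** * Extension of scalars *)

Section AdditiveMaps.
Variables (U V : zmodType) (f : U -> V).
Hypothesis fD : forall x y, f (x + y) = f x + f y.

Lemma add_map0 : f 0 = 0.
Proof. by apply: (@addrI _ (f 0)); rewrite -fD !addr0. Qed.
Lemma add_mapN x : f (- x) = - f x.
Proof. by apply: (@addrI _ (f x)); rewrite -fD !subrr add_map0. Qed.
Lemma add_mapB x y : f (x - y) = f x - f y.
Proof. by rewrite fD add_mapN. Qed.
Lemma add_mapMz x n : f (x *~ n) = f x *~ n.
Proof.
have nat_case k : f (x *+ k) = f x *+ k.
  by elim: k => [|k IH]; rewrite ?mulr0n ?add_map0 // !mulrS fD IH.
by case: n => k; rewrite ?NegzE ?mulrNz ?add_mapN -!pmulrn nat_case.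
Qed.
Lemma add_map_sum I (s : seq I) (P : pred I) (F : I -> U) :
  f (\sum_(i <- s | P i) F i) = \sum_(i <- s | P i) f (F i).
Proof. exact: (big_morph f fD add_map0). Qed.
End AdditiveMaps.

Definition int_span n (E : 'cV[algC]_n) (x : algC) : Prop :=
  exists c : 'rV[int]_n, map_mx intr c *m E = x%:M.

Definition int_free n (E : 'cV[algC]_n) : Prop :=
  forall c : 'rV[int]_n, map_mx intr c *m E = 0 -> c = 0.

(* A relation c, put in Smith form c = L (d,0,...,0) R, says that the first entry of
   the unimodular transform R E of the generators vanishes. *)
Lemma int_span_reduce n (E : 'cV[algC]_n.+1) (c : 'rV[int]_n.+1) :
  c != 0 -> map_mx intr c *m E = 0 ->
  exists E' : 'cV[algC]_n, forall x, int_span E x <-> int_span E' x.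
Proof.
move=> nzc cE; have [L uL [R uR [d _ Dc]]] := int_Smith_normal_form c.
pose E1 : 'cV[algC]_(1 + n) := map_mx intr R *m E.
have intmxM p q t (A : 'M[int]_(p, q)) (B : 'M_(q, t)) :
  map_mx intr (A *m B) = map_mx intr A *m map_mx intr B :> 'M[algC]_(p, t).
  exact: map_mxM.
have RK : E = map_mx intr (invmx R) *m E1.
  by rewrite /E1 mulmxA -intmxM mulVmx // map_mx1 mul1mx.
have DD : \matrix_(i < 1, j < n.+1) (d`_i *+ (i == j :> nat)) =
    row_mx (d`_0)%:M (0 : 'rV_n) :> 'rV[int]_(1 + n).
  apply/rowP => j; rewrite !mxE; case: splitP => k.
    by rewrite !ord1 => ->; rewrite !mxE.
  by move=> ->; rewrite mxE.
have E10 : usubmx E1 = 0.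
  have nzd : d`_0 != 0.
    apply: contraNneq nzc => d0; rewrite Dc DD d0.
    by rewrite (_ : row_mx _ _ = 0) ?mulmx0 ?mul0mx // raddf0 row_mx0.
  move: cE; rewrite Dc !intmxM -!mulmxA -/E1 DD => /(congr1 (mulmx (map_mx intr (invmx L)))).
  rewrite mulmx0 mulmxA -intmxM mulVmx // map_mx1 mul1mx -[E1]vsubmxK.
  rewrite (@map_row_mx int algC intr 1 1 n) (@mul_row_col algC 1 1 n 1) map_mx0.
  rewrite mul0mx addr0 map_scalar_mx mul_scalar_mx.
  move/eqP; rewrite scaler_eq0 intr_eq0 (negPf nzd) /= => /eqP.
  by rewrite col_mxKu.
exists (dsubmx E1) => x; split=> [[b]|[b]].
  rewrite RK -[E1 in X in X -> _]vsubmxK E10 mulmxA -intmxM.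
  set b1 : 'rV[int]_(1 + n) := b *m _; rewrite -[b1]hsubmxK.
  rewrite (@map_row_mx int algC intr 1 1 n) (@mul_row_col algC 1 1 n 1) mulmx0 add0r.
  by exists (rsubmx b1).
move=> Db; exists (row_mx (0 : 'rV_1) b *m R); rewrite intmxM -mulmxA -/E1.
rewrite -[E1]vsubmxK.
by rewrite (@map_row_mx int algC intr 1 1 n) (@mul_row_col algC 1 1 n 1) E10 mulmx0 add0r.
Qed.

(** As long as a nontrivial relation exists, [int_span_reduce] removes one generator. *)
Lemma int_basis_exists n (E : 'cV[algC]_n) :
  exists k (E' : 'cV[algC]_k), int_free E' /\ forall x, int_span E x <-> int_span E' x.
Proof.
elim: n E => [|n IH] E.
  by exists 0%N, E; split=> // c _; apply: thinmx0.
case: (classic (int_free E)) => [fE|nfE]; first by exists n.+1, E.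
have [c [cE nzc]] : exists c : 'rV[int]_n.+1, map_mx intr c *m E = 0 /\ c != 0.
  apply: NNPP => nc; apply: nfE => c cE; apply/eqP.
  by apply: NNPP => /negP nzc; apply: nc; exists c.
have [E1 spE1] := int_span_reduce nzc cE; have [k [E2 [fE2 spE2]]] := IH E1.
by exists k, E2; split=> // x; split=> [/spE1/spE2 | /spE2/spE1].
Qed.

Lemma Aint_lattice (s : seq algC) : {subset s <= Aint} ->
  exists S : subringClosed algC, {subset s <= S} /\
  exists n (E : 'cV[algC]_n), int_free E /\ forall x, x \in S <-> int_span E x.
Proof.
move=> sA; have [S [ringS sS] [[n Y] _ /= spanS]] := Aint_subring_exists sA.
pose SM := GRing.isSubringClosed.Build algC S ringS.
pose S' : subringClosed algC := HB.pack S SM.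
exists S'; split=> //.
have [k [E [fE spE]]] := int_basis_exists (\col_(i < n) Y`_i).
exists k, E; split=> // x; rewrite -spE.
have eqsp c : (map_mx intr c *m (\col_(i < n) Y`_i) = x%:M) <->
    x = \sum_(i < n) Y`_i *~ (c 0 i).
  rewrite [map_mx _ _ *m _]mx11_scalar mxE.
  have -> : \sum_j map_mx intr c 0 j * (\col_i Y`_i) j 0 = \sum_(i < n) Y`_i *~ (c 0 i) :> algC.
    by apply: eq_bigr => i _; rewrite !mxE mulrzl.
  by split=> [/matrixP/(_ 0 0)|->] //; rewrite !mxE eqxx !mulr1n.
split=> [/spanS[c Dx]|[c /eqsp Dx]].
  exists (\row_i c i); apply/eqsp; rewrite Dx; apply: eq_bigr => i _; by rewrite mxE.
by apply/spanS; exists [ffun i => c 0 i]; rewrite Dx; apply: eq_bigr => i _; rewrite ffunE.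
Qed.

Section ScalarExtension.

Variables (S : subringClosed algC) (n : nat) (E : 'cV[algC]_n).
Hypotheses (E_free : int_free E) (E_span : forall x, x \in S <-> int_span E x).

Let e i := E i 0.

Lemma basis_mem i : e i \in S.
Proof.
apply/E_span; exists (delta_mx 0 i); rewrite map_delta_mx -rowE.
by rewrite [row _ _]mx11_scalar mxE.
Qed.

Lemma int_free_mx p (A B : 'M[int]_(p, n)) :
  map_mx intr A *m E = map_mx intr B *m E -> A = B.
Proof.
move=> AB; apply/eqP; rewrite -subr_eq0; apply/eqP/row_matrixP => i; rewrite row0.
apply: E_free; rewrite map_row -row_mul map_mxB mulmxBl AB subrr; exact: row0.
Qed.

(** The boolean implication allows a choice of matrix for every [x]; only the values on [S] have a
    meaning. *)
Lemma mulreg_exists x :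
  exists A : 'M[int]_n, (x \in S) ==> (map_mx intr A *m E == x *: E).
Proof.
have [Sx|] := boolP (x \in S); last by exists 0.
have /fin_all_exists[c Dc] : forall i, exists c : 'rV[int]_n,
    map_mx intr c *m E = (x * e i)%:M.
  by move=> i; apply/E_span; rewrite rpredM ?basis_mem.
exists (\matrix_i c i); apply/eqP/row_matrixP => i.
rewrite row_mul -map_row rowK Dc; apply/rowP => j; rewrite !mxE ord1.
by rewrite eqxx mulr1n.
Qed.

Definition mulreg x : 'M[int]_n := xchoose (mulreg_exists x).

Lemma mulregE x : x \in S -> map_mx intr (mulreg x) *m E = x *: E.
Proof. by move=> Sx; have /implyP/(_ Sx)/eqP := xchooseP (mulreg_exists x). Qed.

Lemma mulregD x y : x \in S -> y \in S -> mulreg (x + y) = mulreg x + mulreg y.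
Proof.
by move=> Sx Sy; apply: int_free_mx; rewrite map_mxD mulmxDl !mulregE ?rpredD // scalerDl.
Qed.

Lemma mulregM x y : x \in S -> y \in S -> mulreg (x * y) = mulreg x *m mulreg y.
Proof.
move=> Sx Sy; apply: int_free_mx; rewrite map_mxM -mulmxA !mulregE ?rpredM //.
by rewrite -scalemxAr mulregE // scalerA mulrC.
Qed.

Lemma mulreg_int (c : int) : mulreg c%:~R = c%:M.
Proof.
by apply: int_free_mx; rewrite mulregE ?rpred_int // map_scalar_mx mul_scalar_mx.
Qed.

Lemma coord_eq (c c' : 'I_n -> int) :
  \sum_k (c k)%:~R * e k = \sum_k (c' k)%:~R * e k -> c =1 c'.
Proof.
move=> H k; have : \row_k c k = \row_k c' k.
  apply: int_free_mx; apply/rowP => j; rewrite ord1 !mxE.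
  by under eq_bigr do rewrite !mxE; under [RHS]eq_bigr do rewrite !mxE.
by move/rowP/(_ k); rewrite !mxE.
Qed.

Lemma mulreg_sum x j : x \in S -> \sum_k (mulreg x j k)%:~R * e k = x * e j.
Proof.
move=> Sx; have /colP/(_ j) := mulregE Sx; rewrite !mxE => <-.
by apply: eq_bigr => k _; rewrite mxE.
Qed.

Lemma mulreg_sym i j k : mulreg (e i) j k = mulreg (e j) i k.
Proof.
by apply: coord_eq k; rewrite !mulreg_sum ?basis_mem // mulrC.
Qed.

(** Both sides are coordinates of [x * e i * e j]. *)
Lemma mulreg_assoc x i j k : x \in S ->
  \sum_m mulreg x i m * mulreg (e m) j k = (mulreg (e i) *m mulreg x) j k.
Proof.
move=> Sx; rewrite -mulregM ?basis_mem //.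
apply: (@coord_eq (fun k => \sum_m mulreg x i m * mulreg (e m) j k)).
rewrite mulreg_sum ?rpredM ?basis_mem //.
transitivity (\sum_m (mulreg x i m)%:~R * (e m * e j)).
  under eq_bigr => l _ do rewrite rmorph_sum mulr_suml.
  rewrite exchange_big /=; apply: eq_bigr => m _.
  rewrite -mulreg_sum ?basis_mem // mulr_sumr; apply: eq_bigr => l _.
  by rewrite rmorphM mulrA.
under eq_bigr => m _ do rewrite mulrA.
by rewrite -mulr_suml mulreg_sum // [x * _]mulrC.
Qed.

Variables (L : zmodType) (br : L -> L -> L) (g : L -> L).
Hypotheses (br_lie : lie_ring br) (g_endo : lie_endo br g).

Let brDl x y z : br (x + y) z = br x z + br y z. Proof. by case: br_lie. Qed.
Let brDr x y z : br x (y + z) = br x y + br x z. Proof. by case: br_lie. Qed.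
Let br_suml w I (s : seq I) P F :
  br (\sum_(i <- s | P i) F i) w = \sum_(i <- s | P i) br (F i) w.
Proof. exact: (add_map_sum (fun x y => brDl x y w)). Qed.
Let br_sumr w I (s : seq I) P F :
  br w (\sum_(i <- s | P i) F i) = \sum_(i <- s | P i) br w (F i).
Proof. exact: (add_map_sum (brDr w)). Qed.
Let br_Mzl x y c : br (x *~ c) y = br x y *~ c.
Proof. exact: (add_mapMz (fun x z => brDl x z y)). Qed.
Let br_Mzr x y c : br x (y *~ c) = br x y *~ c.
Proof. exact: (add_mapMz (brDr x)). Qed.

Lemma lie_brC x y : br x y = - br y x.
Proof.
case: br_lie => _ _ br_alt _; apply/eqP; rewrite -addr_eq0; apply/eqP.
by have := br_alt (x + y); rewrite brDl !brDr !br_alt add0r addr0.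
Qed.

Lemma lie_brJ x y z : br (br x y) z = br (br x z) y + br x (br y z).
Proof.
case: br_lie => _ _ _ /(_ x y z) /eqP; rewrite -addrA addr_eq0 => /eqP ->.
rewrite [br (br x y) z]lie_brC [br y (br z x)]lie_brC [br z x]lie_brC.
by rewrite (add_mapN (fun x z => brDl x z y)) opprK opprD addNKr.
Qed.

(** The tensor product of [L] with [S] in coordinates: [v] stands for the sum of the [v k] tensored
    with [e k]. *)
Definition ext := {ffun 'I_n -> L}.
Definition ext_act (x : algC) (v : ext) : ext :=
  [ffun k => \sum_j v j *~ mulreg x j k].
Definition ext_br (v w : ext) : ext :=
  [ffun k => \sum_i \sum_j br (v i) (w j) *~ mulreg (e i) j k].
Definition ext_endo (v : ext) : ext := [ffun k => g (v k)].

Lemma ext_actDr x v w : ext_act x (v + w) = ext_act x v + ext_act x w.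
Proof.
apply/ffunP => k; rewrite !ffunE -big_split; apply: eq_bigr => j _.
by rewrite ffunE mulrzDl.
Qed.

Lemma ext_actDl x y v : x \in S -> y \in S ->
  ext_act (x + y) v = ext_act x v + ext_act y v.
Proof.
move=> Sx Sy; apply/ffunP => k; rewrite !ffunE -big_split; apply: eq_bigr => j _.
by rewrite mulregD // mxE mulrzDr.
Qed.

Lemma ext_actM x y v : x \in S -> y \in S ->
  ext_act (x * y) v = ext_act x (ext_act y v).
Proof.
move=> Sx Sy; apply/ffunP => k; rewrite !ffunE mulrC mulregM //.
under [RHS]eq_bigr => j _ do rewrite ffunE mulrz_suml.
rewrite exchange_big /=; apply: eq_bigr => i _; rewrite mxE mulrz_sumr.
by apply: eq_bigr => j _; rewrite mulrzA.
Qed.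

Lemma ext_act_int c v : ext_act c%:~R v = v *~ c.
Proof.
apply/ffunP => k; rewrite !ffunE mulreg_int (bigD1 k) //= big1 => [|j /negPf njk].
  by rewrite mxE eqxx mulr1n addr0 ffunMzE.
by rewrite mxE njk mulr0n mulr0z.
Qed.

Lemma ext_brDl u v w : ext_br (u + v) w = ext_br u w + ext_br v w.
Proof.
apply/ffunP => k; rewrite !ffunE -big_split; apply: eq_bigr => i _.
rewrite -big_split; apply: eq_bigr => j _; by rewrite ffunE brDl mulrzDl.
Qed.

Lemma ext_brC v w : ext_br v w = - ext_br w v.
Proof.
apply/ffunP => k; rewrite !ffunE exchange_big -sumrN; apply: eq_bigr => i _.
rewrite -sumrN; apply: eq_bigr => j _.
by rewrite lie_brC mulNrz mulreg_sym.
Qed.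

Lemma ext_brDr u v w : ext_br u (v + w) = ext_br u v + ext_br u w.
Proof. by rewrite ext_brC ext_brDl opprD -!ext_brC. Qed.

Lemma ext_br_actl x v w : x \in S -> ext_br (ext_act x v) w = ext_act x (ext_br v w).
Proof.
move=> Sx; apply/ffunP => k; rewrite !ffunE.
transitivity (\sum_i \sum_j br (v i) (w j) *~ (mulreg (e i) *m mulreg x) j k).
  under eq_bigr => m _ do under eq_bigr => j _ do rewrite ffunE br_suml mulrz_suml.
  under eq_bigr => m _ do rewrite exchange_big /=.
  rewrite exchange_big /=; apply: eq_bigr => i _; rewrite exchange_big /=.
  apply: eq_bigr => j _; rewrite -mulreg_assoc // mulrz_sumr.
  by apply: eq_bigr => m _; rewrite br_Mzl mulrzA.
under [RHS]eq_bigr => m _ do rewrite ffunE mulrz_suml.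
rewrite [RHS]exchange_big /=; apply: eq_bigr => i _.
under [RHS]eq_bigr => m _ do rewrite mulrz_suml.
rewrite [RHS]exchange_big /=; apply: eq_bigr => j _.
by rewrite mxE mulrz_sumr; apply: eq_bigr => m _; rewrite mulrzA.
Qed.

Lemma ext_br_actr x v w : x \in S -> ext_br v (ext_act x w) = ext_act x (ext_br v w).
Proof.
move=> Sx; rewrite ext_brC ext_br_actl // [ext_br v w]ext_brC.
by rewrite (add_mapN (ext_actDr x)).
Qed.

(** Coordinate [l] of [e h * e i * e j]. Its symmetry reduces the Jacobi identity on [ext] to that
    of [L], coefficient by coefficient. *)
Let tri h i j l := (mulreg (e i) *m mulreg (e h)) j l.

Lemma ext_br_brl u v w l : ext_br (ext_br u v) w l =
  \sum_h \sum_i \sum_j br (br (u h) (v i)) (w j) *~ tri h i j l.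
Proof.
rewrite !ffunE.
under eq_bigr => m _ do under eq_bigr => j _ do rewrite ffunE br_suml mulrz_suml.
under eq_bigr => m _ do rewrite exchange_big /=.
rewrite exchange_big /=; apply: eq_bigr => h _.
under eq_bigr => m _ do under eq_bigr => j _ do rewrite br_suml mulrz_suml.
under eq_bigr => m _ do rewrite exchange_big /=.
rewrite exchange_big /=; apply: eq_bigr => i _; rewrite exchange_big /=.
apply: eq_bigr => j _; rewrite /tri -mulreg_assoc ?basis_mem // mulrz_sumr.
apply: eq_bigr => m _; rewrite br_Mzl mulreg_sym; by rewrite mulrzA.
Qed.

Lemma ext_br_brr u v w l : ext_br u (ext_br v w) l =
  \sum_h \sum_i \sum_j br (u h) (br (v i) (w j)) *~ tri h i j l.
Proof.
rewrite !ffunE; apply: eq_bigr => h _.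
under eq_bigr => m _ do rewrite ffunE br_sumr mulrz_suml.
rewrite exchange_big /=; apply: eq_bigr => i _.
under eq_bigr => m _ do rewrite br_sumr mulrz_suml.
rewrite exchange_big /=; apply: eq_bigr => j _.
by rewrite /tri mxE mulrz_sumr; apply: eq_bigr => m _; rewrite br_Mzr mulrzA.
Qed.

Lemma tri_sym h i j l : tri h i j l = tri h j i l.
Proof.
rewrite /tri -!mulregM ?basis_mem //.
apply: (@coord_eq (fun l => mulreg (e i * e h) j l)).
by rewrite !mulreg_sum ?rpredM ?basis_mem // mulrAC [RHS]mulrAC [e i * e j]mulrC.
Qed.

Lemma ext_brJ u v w :
  ext_br (ext_br u v) w = ext_br (ext_br u w) v + ext_br u (ext_br v w).
Proof.
apply/ffunP => l; rewrite [in RHS]ffunE !ext_br_brl ext_br_brr -big_split.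
apply: eq_bigr => h _; rewrite [X in _ = X + _]exchange_big -big_split.
apply: eq_bigr => i _; rewrite -big_split; apply: eq_bigr => j _.
by rewrite /= -[tri h j i l]tri_sym -mulrzDl -lie_brJ.
Qed.

Lemma ext_endoD v w : ext_endo (v + w) = ext_endo v + ext_endo w.
Proof. by apply/ffunP => k; rewrite !ffunE; case: g_endo. Qed.

Lemma ext_endo_act x v : ext_endo (ext_act x v) = ext_act x (ext_endo v).
Proof.
case: g_endo => gD _; apply/ffunP => k; rewrite !ffunE (add_map_sum gD).
by apply: eq_bigr => j _; rewrite ffunE (add_mapMz gD).
Qed.

Lemma ext_endo_br v w : ext_endo (ext_br v w) = ext_br (ext_endo v) (ext_endo w).
Proof.
case: g_endo => gD gM; apply/ffunP => k; rewrite !ffunE (add_map_sum gD).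
apply: eq_bigr => i _; rewrite (add_map_sum gD); apply: eq_bigr => j _.
by rewrite !ffunE (add_mapMz gD) gM.
Qed.

Lemma ext_endo_poly (r : {poly int}) :
  (forall v : L, \sum_(i < size r) (iter i g v) *~ r`_i = 0) ->
  forall v : ext, \sum_(i < size r) (iter i ext_endo v) *~ r`_i = 0.
Proof.
move=> rg v; apply/ffunP => k; rewrite sum_ffunE ffunE -[RHS](rg (v k)).
apply: eq_bigr => i _; rewrite ffunMzE; congr (_ *~ _).
by elim: (i : nat) => //= m IH; rewrite ffunE IH.
Qed.

Lemma ext_torsion_free (c : int) : (forall v : L, v *~ c = 0 -> v = 0) ->
  forall v : ext, v *~ c = 0 -> v = 0.
Proof.
move=> tf v /ffunP vc; apply/ffunP => k; rewrite ffunE; apply: tf.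
by have := vc k; rewrite ffunMzE ffunE.
Qed.

(** [u] is sent to [u] tensored with 1, where [c] holds the coordinates of 1. *)
Lemma ext_embedding : exists iota : L -> ext,
  [/\ forall u v, iota (u + v) = iota u + iota v,
      forall u v, ext_br (iota u) (iota v) = iota (br u v)
    & forall u, iota u = 0 -> u = 0].
Proof.
have [c Dc] : int_span E 1 by apply/E_span; apply: rpred1.
have Dc' : \sum_k (c 0 k)%:~R * e k = 1.
  have /matrixP/(_ 0 0) := Dc; rewrite !mxE eqxx mulr1n => H; rewrite -[RHS]H.
  by apply: eq_bigr => k _; rewrite mxE.
have unit j k : \sum_i c 0 i * mulreg (e i) j k = (j == k)%:R.
  have -> : (j == k)%:R = mulreg 1 j k by rewrite (mulreg_int 1) mxE.
  apply: (@coord_eq (fun k => \sum_i c 0 i * mulreg (e i) j k)).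
  rewrite mulreg_sum ?rpred1 //.
  transitivity ((\sum_k (c 0 k)%:~R * e k) * e j); last by rewrite Dc'.
  rewrite mulr_suml.
  under eq_bigr => l _ do rewrite rmorph_sum mulr_suml.
  rewrite exchange_big /=; apply: eq_bigr => m _.
  rewrite -mulrA -mulreg_sum ?basis_mem // mulr_sumr; apply: eq_bigr => l _.
  by rewrite rmorphM mulrA.
exists (fun u => [ffun k => u *~ c 0 k]); split=> [u v|u v|u].
- by apply/ffunP => k; rewrite !ffunE mulrzDl.
- apply/ffunP => k; rewrite !ffunE exchange_big /=.
  transitivity (\sum_j br u v *~ (c 0 j * \sum_i c 0 i * mulreg (e i) j k)).
    apply: eq_bigr => j _; rewrite mulr_sumr mulrz_sumr; apply: eq_bigr => i _.
    by rewrite !ffunE br_Mzl br_Mzr -!mulrzA; congr (_ *~ _); ring.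
  rewrite -mulrz_sumr; congr (_ *~ _); rewrite (bigD1 k) //= unit eqxx mulr1.
  by rewrite big1 ?addr0 // => j /negPf njk; rewrite unit njk mulr0.
move/ffunP => uc.
have n_gt0 : (0 < n)%N.
  rewrite lt0n; apply/eqP => n0; have := oner_neq0 algC; rewrite -Dc' big1 ?eqxx //.
  by case=> k ltk; exfalso; move: ltk; rewrite n0.
pose j := Ordinal n_gt0.
(* Some integer combination of the [c 0 i] is 1, so [u] vanishes with all its multiples by them. *)
have -> : u = u *~ \sum_i c 0 i * mulreg (e i) j j by rewrite unit eqxx.
rewrite mulrz_sumr big1 // => i _; rewrite mulrzA.
by have := uc i; rewrite !ffunE => ->; rewrite mul0rz.
Qed.

End ScalarExtension.

(** * Generalized eigenspaces *)

Section Eigenspaces.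

Variables (V : zmodType) (br : V -> V -> V) (g : V -> V).
Variables (S : subringClosed algC) (act : algC -> V -> V).
Hypothesis brDl : forall x y z, br (x + y) z = br x z + br y z.
Hypothesis brDr : forall x y z, br x (y + z) = br x y + br x z.
Hypothesis gD : forall v w, g (v + w) = g v + g w.
Hypothesis g_br : forall v w, g (br v w) = br (g v) (g w).
Hypothesis actDr : forall x v w, act x (v + w) = act x v + act x w.
Hypothesis actDl : forall x y v, x \in S -> y \in S -> act (x + y) v = act x v + act y v.
Hypothesis actM : forall x y v, x \in S -> y \in S -> act (x * y) v = act x (act y v).
Hypothesis act_int : forall (c : int) v, act c%:~R v = v *~ c.
Hypothesis g_act : forall x v, g (act x v) = act x (g v).
Hypothesis br_actl : forall x v w, x \in S -> br (act x v) w = act x (br v w).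
Hypothesis br_actr : forall x v w, x \in S -> br v (act x w) = act x (br v w).

Let br_Mzl x y c : br (x *~ c) y = br x y *~ c.
Proof. exact: (add_mapMz (fun x z => brDl x z y)). Qed.
Let br_Mzr x y c : br x (y *~ c) = br x y *~ c.
Proof. exact: (add_mapMz (brDr x)). Qed.

Variable A : int.
Let a : algC := A%:~R.
Let Sa : a \in S. Proof. exact: rpred_int. Qed.

Let actC x y v : x \in S -> y \in S -> act x (act y v) = act y (act x v).
Proof. by move=> Sx Sy; rewrite -!actM // mulrC. Qed.

Let act0l v : act 0 v = 0. Proof. by rewrite (act_int 0) mulr0z. Qed.

Let actNl x v : x \in S -> act (- x) v = - act x v.
Proof.
move=> Sx; apply: (@addrI _ (act x v)).
by rewrite -actDl ?rpredN // !subrr act0l.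
Qed.

Let act_sum v (I : Type) (s : seq I) (F : I -> algC) : (forall i, F i \in S) ->
  act (\sum_(i <- s) F i) v = \sum_(i <- s) act (F i) v.
Proof.
move=> SF; elim: s => [|i s IH]; first by rewrite !big_nil act0l.
by rewrite !big_cons actDl ?IH // rpred_sum.
Qed.

(** The root [x] need not lie in [S], but [a * x] does; hence [A g - a x] replaces [g - x]. *)
Definition scg v := g v *~ A.
Definition shift b v := scg v - act b v.

Lemma scgD v w : scg (v + w) = scg v + scg w.
Proof. by rewrite /scg gD mulrzDl. Qed.

Lemma scg_act x v : scg (act x v) = act x (scg v).
Proof. by rewrite /scg g_act (add_mapMz (actDr x)). Qed.

Lemma shiftD b v w : shift b (v + w) = shift b v + shift b w.
Proof. by rewrite /shift scgD actDr opprD addrACA. Qed.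

Lemma shift_act b x v : b \in S -> x \in S -> shift b (act x v) = act x (shift b v).
Proof. by move=> Sb Sx; rewrite /shift scg_act actC // (add_mapB (actDr x)). Qed.

Lemma shift_scg b v : shift b (scg v) = scg (shift b v).
Proof. by rewrite /shift (add_mapB scgD) scg_act. Qed.

Lemma shiftC b c v : b \in S -> c \in S -> shift b (shift c v) = shift c (shift b v).
Proof.
move=> Sb Sc; rewrite /shift !(add_mapB scgD) !scg_act.
rewrite (add_mapB (actDr b)) (add_mapB (actDr c)) actC //.
by rewrite !opprD !opprK !addrA; congr (_ + _); rewrite addrAC.
Qed.

Lemma iterD_map (T : V -> V) k : (forall v w, T (v + w) = T v + T w) ->
  forall v w, iter k T (v + w) = iter k T v + iter k T w.
Proof. by move=> TD v w; elim: k => //= k ->; rewrite TD. Qed.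

Lemma iter_comm (T U : V -> V) k : (forall v, T (U v) = U (T v)) ->
  forall v, iter k T (U v) = U (iter k T v).
Proof. by move=> TU v; elim: k => //= k ->; rewrite TU. Qed.

Definition geig b v := exists k, iter k (shift b) v = 0.

Lemma iter_shift0 b k : iter k (shift b) 0 = 0.
Proof. exact: (add_map0 (iterD_map k (shiftD b))). Qed.

Lemma geig_closed b : sub_closed (geig b).
Proof.
split=> [|v w [k kv] [j jw]]; first by exists 0%N.
exists (k + j)%N; rewrite (add_mapB (iterD_map _ (shiftD b))).
by rewrite {1}addnC !iterD kv jw !iter_shift0 subrr.
Qed.

Lemma geig_Mz b v n : geig b v -> geig b (v *~ n).
Proof.
by case=> k kv; exists k; rewrite (add_mapMz (iterD_map k (shiftD b))) kv mul0rz.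
Qed.

(** For brackets: a product of two scaled eigenvalues carries two factors [A]. *)
Definition mixed s v := g v *~ (A * A) - act s v.

Lemma mixedD s v w : mixed s (v + w) = mixed s v + mixed s w.
Proof. by rewrite /mixed gD actDr mulrzDl opprD addrACA. Qed.

(** The term [br (act b v) (scg w)] is subtracted and added. *)
Lemma mixed_br b c v w : b \in S -> c \in S ->
  mixed (b * c) (br v w) = br (shift b v) (scg w) + br (act b v) (shift c w).
Proof.
move=> Sb Sc; rewrite /shift (add_mapB (fun x z => brDl x z (scg w))).
rewrite (add_mapB (brDr (act b v))) addrA subrK /mixed g_br /scg.
by rewrite br_Mzl br_Mzr -mulrzA br_actr // br_actl // -actM // [c * b]mulrC.
Qed.

(** Each use of [mixed_br] lowers one of the two nilpotency exponents and keeps the other. *)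
Lemma iter_mixed_br b c n k j v w : b \in S -> c \in S -> (k + j <= n)%N ->
  iter k (shift b) v = 0 -> iter j (shift c) w = 0 ->
  iter n (mixed (b * c)) (br v w) = 0.
Proof.
move=> Sb Sc; elim: n k j v w => [|n IH] k j v w.
  rewrite leqn0 addn_eq0 => /andP[/eqP-> _] /= -> _.
  by rewrite (add_map0 (fun x z => brDl x z w)).
have it0 m : iter m (mixed (b * c)) 0 = 0.
  exact: (add_map0 (iterD_map m (mixedD (b * c)))).
case: k => [|k] kj kv jw.
  by rewrite [v]kv (add_map0 (fun x z => brDl x z w)) it0.
case: j kj jw => [|j] kj jw.
  by rewrite [w]jw (add_map0 (brDr v)) it0.
rewrite iterSr mixed_br // (iterD_map _ (mixedD _)).
rewrite (IH k j.+1) ?add0r //.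
- rewrite (IH k.+1 j) //; first by rewrite addSnnS.
    rewrite (@iter_comm _ (act b)) ?kv ?(add_map0 (actDr b)) // => u.
    exact: shift_act.
  by rewrite -iterSr.
- by rewrite -iterSr.
rewrite (@iter_comm _ scg) ?jw ?(add_map0 scgD) // => u; exact: shift_scg.
Qed.

Definition shifts bs v := foldr shift v bs.

Lemma shift_shifts b bs v : b \in S -> all (mem S) bs ->
  shift b (shifts bs v) = shifts bs (shift b v).
Proof.
by move=> Sb; elim: bs => //= c bs IH /andP[Sc Sbs]; rewrite shiftC // IH.
Qed.

(** Here [m] is only a bound on the number of terms: the induction calls on both [m] and [m.+1]. *)
Lemma shiftsE bs m v : all (mem S) bs -> (size bs < m)%N ->
  shifts bs v = \sum_(k < m) act (\prod_(b <- bs) ('X - b%:P))`_k (iter k scg v).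
Proof.
elim: bs m => [|b bs IH] [|m] //= Sbs ltm.
  rewrite big_nil big_ord_recl /= coef1 (act_int 1) mulr1z big1 ?addr0 // => k _.
  by rewrite coef1 act0l.
case/andP: Sbs => Sb Sbs; rewrite big_cons; set p := \prod_(b <- bs) _ in IH *.
have Sp k : p`_k \in S.
  have : p \is a polyOver S.
    rewrite /p big_seq rpred_prod // => c /(allP Sbs) Sc; by rewrite polyOverXsubC.
  by move/polyOverP; apply.
transitivity (\sum_(k < m.+1) (act ('X * p)`_k (iter k scg v) -
    act b (act p`_k (iter k scg v)))); last first.
  apply: eq_bigr => k _; rewrite mulrBl coefB coefCM actDl ?rpredN ?rpredM //.
    by rewrite actNl ?rpredM // actM.
  by rewrite coefXM; case: ifP; rewrite ?rpred0.
rewrite /shift sumrB; congr (_ - _).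
  rewrite (IH m) // (add_map_sum scgD) big_ord_recl /= coefXM eqxx act0l add0r.
  by apply: eq_bigr => k _; rewrite scg_act coefXM.
by rewrite (IH m.+1) ?(ltnW ltm) // (add_map_sum (actDr b)).
Qed.

Lemma iter_scg k v : iter k scg v = iter k g v *~ (A ^+ k).
Proof.
elim: k => [|k IH]; first by rewrite expr0 mulr1z.
by rewrite !iterS IH /scg (add_mapMz gD) -mulrzA exprSr.
Qed.

Variable N : int.
Hypothesis N_tf : forall v : V, v *~ N = 0 -> v = 0.

Lemma act_dvd_inj x q v : x \in S -> q \in S -> N%:~R = q * x -> act x v = 0 -> v = 0.
Proof.
move=> Sx Sq DN xv; apply: N_tf.
by rewrite -act_int DN actM // xv (add_map0 (actDr q)).
Qed.

(** On vectors killed by a power of [shift c], [shift b] is the scalar [c - b] plus a nilpotent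
    operator. As [c - b] divides [N], successive corrections invert it up to [N ^+ k]. *)
Lemma shift_solve b c q k u : b \in S -> c \in S -> q \in S -> N%:~R = q * (c - b) ->
  iter k (shift c) u = 0 ->
  exists w, iter k (shift c) w = 0 /\ shift b w = u *~ (N ^+ k).
Proof.
move=> Sb Sc Sq DN; elim: k u => [|k IH] u ku.
  by exists 0; split=> //; rewrite [u]ku mul0rz (add_map0 (shiftD b)).
have shb : shift b u = shift c u + act (c - b) u.
  by rewrite /shift actDl ?rpredN // actNl // addrA subrK.
have shq m v : iter m (shift c) (act q v) = act q (iter m (shift c) v).
  by apply: iter_comm => z; apply: shift_act.
have itD m := iterD_map m (shiftD c).
have [|w1 [kw1 Dw1]] := IH (- act q (shift c u)).
  by rewrite (add_mapN (itD k)) shq -iterSr ku (add_map0 (actDr q)) oppr0.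
exists (act q u *~ (N ^+ k) + w1); split.
  rewrite itD (add_mapMz (itD _)) shq ku (add_map0 (actDr q)) mul0rz add0r.
  by rewrite iterS kw1 (add_map0 (shiftD c)).
rewrite shiftD (add_mapMz (shiftD b)) shift_act // shb actDr -actM ?rpredB //.
by rewrite -DN act_int Dw1 -mulrzDl addrAC subrr add0r -mulrzA -exprS.
Qed.

Variable r : {poly int}.
Hypothesis szr : (1 < size r)%N.
Hypothesis lead_r : A = lead_coef r.
Hypothesis rg : forall v, \sum_(i < size r) (iter i g v) *~ r`_i = 0.
Hypothesis DN : N%:~R = Discr_star r * Prod_star r.
Hypothesis S_roots : {in droots r, forall x, a * x \in S}.

Let nzr : r != 0. Proof. by rewrite -size_poly_gt0 ltnW. Qed.
Let S_roots' : {in droots r, forall x, (lead_coef r)%:~R * x \in S}.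
Proof. by move=> x; rewrite -lead_r; apply: S_roots. Qed.

Lemma lead_tf (v : V) : v *~ A = 0 -> v = 0.
Proof.
have [q Sq Dq] := torsion_dvd_lead szr S_roots'.
by rewrite -act_int; apply: (act_dvd_inj Sa Sq); rewrite DN Dq -lead_r.
Qed.

Lemma leadX_tf k (v : V) : v *~ (A ^+ k) = 0 -> v = 0.
Proof.
by elim: k => [|k IH]; rewrite ?expr0 ?mulr1z // exprSr mulrzA => /lead_tf.
Qed.

(** The composite is [scaled_poly r] evaluated at [A g], that is a^(d-1) r(g). A further factor [A],
    put in to apply [scaled_polyE], is cancelled by [lead_tf]. *)
Lemma shifts_roots v : shifts [seq a * x | x <- roots_mult r] v = 0.
Proof.
have Sbs : all (mem S) [seq a * x | x <- roots_mult r].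
  by apply/allP => _ /mapP[x xr ->]; apply: S_roots; rewrite mem_undup.
rewrite (@shiftsE _ (size r)) //; last first.
  by rewrite size_map size_roots_mult // prednK // ltnW.
rewrite big_map -[a]/(A%:~R) lead_r -/(scaled_poly r).
apply: lead_tf.
transitivity ((\sum_(i < size r) iter i g v *~ r`_i) *~ (A ^+ (size r).-1)); last first.
  by rewrite rg mul0rz.
rewrite !mulrz_suml.
apply: eq_bigr => k _; have Sk : (scaled_poly r)`_k \in S.
  by have /intrP[c ->] := scaled_poly_int k nzr; apply: rpred_int.
rewrite iter_scg -!act_int -!actM ?rpredM ?rpred_int //; congr act.
by have := scaled_polyE k nzr; rewrite -lead_r !rmorphXn /= mulrAC => ->.
Qed.

Definition eigfam x v := if x \in droots r then geig (a * x) v else v = 0.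

Lemma eigfam_closed : fam_closed eigfam.
Proof.
move=> x; rewrite /eigfam; case: (x \in droots r); first exact: geig_closed.
by split=> // v w -> ->; rewrite subr0.
Qed.

Lemma eigfam_supp x v : eigfam x v -> x \notin droots r -> v = 0.
Proof. by rewrite /eigfam => Cv /negPf nx; rewrite nx in Cv. Qed.

(** If [A * A] times [g v] is [s v], then evaluating [r] at [g] shows that a^(2d) r(x y) kills [v];
    this number divides [N]. *)
Lemma mixed_inj x y v : x \in droots r -> y \in droots r -> x * y \notin droots r ->
  mixed ((a * x) * (a * y)) v = 0 -> v = 0.
Proof.
move=> xr yr nxy; set s := a * x * (a * y) => /eqP; rewrite subr_eq0 => /eqP Ds.
have Ss : s \in S by rewrite rpredM ?S_roots.
have powers k : iter k g v *~ ((A * A) ^+ k) = act (s ^+ k) v.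
  elim: k => [|k IH]; first by rewrite expr0 mulr1z (act_int 1) mulr1z.
  rewrite iterS exprSr mulrzA -(add_mapMz gD) IH g_act -(add_mapMz (actDr _)) Ds.
  by rewrite -actM ?rpredX // exprSr.
have nz : (rC r).[x * y] != 0 by move: nxy; rewrite mem_droots.
have [q Sq Dq] := torsion_dvd_val szr S_roots' xr yr nz.
apply: (act_dvd_inj (scaled_val_mem szr S_roots' xr yr) Sq); first by rewrite DN Dq.
rewrite horner_coef size_rC mulr_sumr -lead_r -/a; set d := (size r).-1.
have Dk (k : 'I_(size r)) : a ^+ (2 * d) * ((rC r)`_k * (x * y) ^+ k) =
    (r`_k * (A * A) ^+ (d - k))%:~R * s ^+ k.
  have -> : (2 * d = 2 * k + 2 * (d - k))%N.
    by have := ltn_ord k; rewrite /d; move: szr; lia.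
  rewrite coef_map /= rmorphM rmorphXn rmorphM /= -/a /s mulrACA -expr2.
  rewrite [(_ * (x * y)) ^+ k]exprMn exprD -!exprM.
  by move: (a ^+ (2 * k)) (a ^+ (2 * (d - k))) ((x * y) ^+ k) => *; ring.
rewrite (eq_bigr _ (fun k _ => Dk k)) act_sum => [|k]; last first.
  by rewrite rpredM ?rpred_int ?rpredX.
transitivity ((\sum_(i < size r) iter i g v *~ r`_i) *~ ((A * A) ^+ d)); last first.
  by rewrite rg mul0rz.
rewrite mulrz_suml; apply: eq_bigr => k _.
rewrite actM ?rpred_int ?rpredX // act_int -powers -!mulrzA; congr (_ *~ _).
have -> : (A * A) ^+ d = (A * A) ^+ k * (A * A) ^+ (d - k).
  by rewrite -exprD subnKC //; have := ltn_ord k; rewrite /d; move: szr; lia.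
by rewrite mulrCA mulrA.
Qed.

(** A power of [mixed] kills the bracket. If [x * y] is not a root, [mixed_inj] makes the bracket
    zero; otherwise [mixed] is [A] times a shift, and powers of [A] cancel. *)
Lemma eigfam_br : subfam (gbr br eigfam eigfam) eigfam.
Proof.
apply: gbr_min => [|x y v w]; first exact: eigfam_closed.
rewrite {1 2}/eigfam; case: ifP => [xr|_ -> _]; last first.
  by rewrite (add_map0 (fun x z => brDl x z w)); case: (eigfam_closed (x * y)).
case: ifP => [yr|_ _ ->]; last first.
  by rewrite (add_map0 (brDr v)); case: (eigfam_closed (x * y)).
move=> [k kv] [j jw]; have Sx := S_roots xr; have Sy := S_roots yr.
have := iter_mixed_br Sx Sy (leqnn (k + j)) kv jw; move: (k + j)%N => n.
rewrite /eigfam; case: ifP => [xyr|/negbT xyr]; last first.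
  by elim: n => //= n IH /(mixed_inj xr yr xyr).
have mx u : mixed (a * x * (a * y)) u = shift (a * (x * y)) u *~ A.
  have -> : a * x * (a * y) = a * (a * (x * y)) by ring.
  by rewrite /mixed /shift /scg actM ?S_roots // act_int mulrzBl mulrzA.
have itmx m u : iter m (mixed (a * x * (a * y))) u =
    iter m (shift (a * (x * y))) u *~ (A ^+ m).
  elim: m => [|m IH]; first by rewrite expr0 mulr1z.
  by rewrite !iterS IH mx (add_mapMz (shiftD _)) -mulrzA exprSr.
by rewrite itmx => /leadX_tf nv; exists n.
Qed.

(** Components of weight other than [x] are solved by [shift_solve], the one of weight [x] goes into
    [c]; cross-multiplication by powers of [N] reconciles the summands. *)
Lemma span_solve x u : x \in droots r -> total_span eigfam u ->
  exists K w c, [/\ total_span eigfam w, geig (a * x) c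
    & u *~ (N ^+ K) = shift (a * x) w + c].
Proof.
move=> xr; have [g0 gB] := geig_closed (a * x); have sh0 := add_map0 (shiftD (a * x)).
elim=> {u} [u [y]||u1 u2 _ [K1 [w1 [c1 [Tw1 gc1 E1]]]] _ [K2 [w2 [c2 [Tw2 gc2 E2]]]]].
- rewrite {1}/eigfam; case: ifP => [yr [k ku]|_ ->]; last first.
    by exists 0%N, 0, 0; split=> //; rewrite ?mul0rz ?sh0 ?addr0 //; apply: zspan0.
  have [<-|nyx] := eqVneq y x.
    exists 0%N, 0, u; split; first exact: zspan0.
      by exists k.
    by rewrite expr0 mulr1z (add_map0 (shiftD _)) add0r.
  have [q Sq Dq] := torsion_dvd_diff szr S_roots' yr xr nyx.
  have DN' : N%:~R = q * (a * y - a * x) by rewrite -mulrBr DN Dq -lead_r.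
  have [w [kw Dw]] := shift_solve (S_roots xr) (S_roots yr) Sq DN' ku.
  exists k, w, 0; split=> //; last by rewrite Dw addr0.
  by apply: zspan_gen; exists y; rewrite /eigfam yr; exists k.
- by exists 0%N, 0, 0; split=> //; rewrite ?mul0rz ?sh0 ?addr0 //; apply: zspan0.
exists (K1 + K2)%N, (w1 *~ (N ^+ K2) - w2 *~ (N ^+ K1)), (c1 *~ (N ^+ K2) - c2 *~ (N ^+ K1)).
split.
- by apply: zspanB; apply: zspanMz.
- by apply: gB; apply: geig_Mz.
rewrite mulrzBl {1}exprD mulrzA E1 addnC exprD mulrzA E2.
rewrite (add_mapB (shiftD _)) !(add_mapMz (shiftD _)) !mulrzDl opprD.
by rewrite addrACA.
Qed.

Lemma span_shifts xs (v : V) : {subset xs <= droots r} ->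
  shifts [seq a * x | x <- xs] v = 0 -> exists K, total_span eigfam (v *~ (N ^+ K)).
Proof.
elim: xs v => [|x xs IH] v sub /=.
  by move=> ->; exists 0%N; rewrite mul0rz; apply: zspan0.
have xr : x \in droots r by apply: sub; rewrite mem_head.
have sub' : {subset xs <= droots r} by move=> y ys; apply: sub; rewrite inE ys orbT.
rewrite shift_shifts ?S_roots //; last first.
  by apply/allP => _ /mapP[y /sub' yr ->]; apply: S_roots.
move/(IH _ sub') => [K TK]; have [K' [w [c [Tw [k kc] E]]]] := span_solve xr TK.
exists (K + K')%N; rewrite exprD mulrzA.
(* By [E] the shift sends [v' - w] to [c], so this difference is a generalized eigenvector for
   [a * x]. *)
set v' := v *~ _ *~ _; rewrite -(subrK w v'); apply: zspanD => //.
apply: zspan_gen; exists x; rewrite /eigfam xr; exists k.+1; rewrite iterSr.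
rewrite (add_mapB (shiftD _)) /v' !(add_mapMz (shiftD _)) E.
by rewrite [_ + c]addrC addrK.
Qed.

Lemma eig_decomposition (v : V) : exists K, total_span eigfam (v *~ (N ^+ K)).
Proof. by apply: (span_shifts _ (shifts_roots v)) => x; rewrite mem_undup. Qed.

End Eigenspaces.

(** * Descent from the scalar extension to [L] *)

Theorem theorem1p12 (L : zmodType) (br : L -> L -> L) (g : L -> L)
    (r : {poly int}) :
  lie_ring br -> lie_endo br g -> good_poly r ->
  (forall v : L, \sum_(i < size r) (iter i g v) *~ r`_i = 0) ->
  (forall N : int, N%:~R = Discr_star r * Prod_star r -> ~ has_torsion L N) ->
  nilpotent_class_le br (((size r).-1) ^ (2 ^ ((size r).-1)))%N.
Proof.
move=> br_lie g_endo r_good rg tors.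
have [r0 r1] := good_nonroot r_good.
have nzr : r != 0 by apply: contraNneq r0 => ->; rewrite horner0.
have tf (N : int) : N%:~R = Discr_star r * Prod_star r ->
    forall v : L, v *~ N = 0 -> v = 0.
  move=> DN v vN; apply/eqP; apply/negPn/negP => nzv.
  by apply: (tors N DN); exists v.
(* A constant [r] kills [L], so [L] is zero by absence of torsion, in accordance with the bound
   [0 ^ 1 = 0]. *)
have [szr|szr] := leqP (size r) 1.
  have sz1 : size r = 1%N by apply/eqP; rewrite eqn_leq szr size_poly_gt0.
  rewrite sz1 => x _; apply: (tf r`_0); first by rewrite /Discr_star /Prod_star szr mulr1.
  by have := rg x; rewrite sz1 big_ord_recl big_ord0 addr0.
have [N DN] := torsion_int szr; have {tors} tfL := tf N DN.
have [S [sS [n [E [freeE spanE]]]]] : exists S : subringClosed algC,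
  {subset [seq (lead_coef r)%:~R * x | x <- droots r] <= S} /\
  exists n (E : 'cV[algC]_n), int_free E /\ forall x, x \in S <-> int_span E x.
  by apply: Aint_lattice => _ /mapP[x xr ->]; apply: scaled_root_Aint.
have S_roots : {in droots r, forall x, (lead_coef r)%:~R * x \in S}.
  by move=> x xr; apply: sS; apply: map_f.
pose brV := ext_br spanE br; pose gV := @ext_endo n L g.
pose act := @ext_act S n E spanE L.
have brVDl := ext_brDl spanE br_lie; have brVDr := ext_brDr freeE spanE br_lie.
have actDr := @ext_actDr S n E spanE L.
have actDl := @ext_actDl S n E freeE spanE L.
have actM := @ext_actM S n E freeE spanE L.
have act_int := @ext_act_int S n E freeE spanE L.
have gVD := @ext_endoD n L br g g_endo.
have gVbr := ext_endo_br spanE g_endo.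
have gVact := ext_endo_act spanE g_endo.
have bractl := ext_br_actl freeE spanE br_lie.
have bractr := ext_br_actr freeE spanE br_lie.
have rgV := @ext_endo_poly n L g r rg.
have tfV := @ext_torsion_free n L N tfL.
pose C := eigfam gV act (lead_coef r) r.
have C_lie : lie_closed brV C.
  split; first exact: eigfam_closed.
  exact: (eigfam_br brVDl brVDr gVD gVbr actDr actDl actM act_int gVact bractl bractr
    tfV szr erefl rgV DN S_roots).
have decomp := eig_decomposition gVD actDr actDl actM act_int gVact tfV szr erefl rgV DN S_roots.
pose X := sort (relpre alg_plane (@arg_le _)) (droots r).
have memX x : (x \in X) = root (rC r) x by rewrite mem_sort mem_droots.
have n0 : 0 \notin droots r.
  by rewrite mem_droots // /root -[X in _.[X]]/(0%:~R) rC_int intr_eq0.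
have n1 : 1 \notin droots r.
  by rewrite mem_droots // /root -[X in _.[X]]/(1%:~R) rC_int intr_eq0.
set d := (size r).-1.
have szX : (size X <= d)%N by rewrite size_sort /d -size_roots_mult // size_undup.
have C0 x v : glcs brV C (d ^ (2 ^ d)) x v -> v = 0.
  apply: (glcs_eq0_leq brVDl (nilbound_leq szX)) => y w.
  apply: (glcs_class brVDl brVDr (ext_brJ freeE spanE br_lie)) => //.
  - by move=> z u Cu nXz; apply: (eigfam_supp Cu); rewrite mem_sort in nXz.
  - exact: sorted_no_middle.
  - by rewrite mem_sort.
  - by rewrite mem_sort.
  - by move=> z u; rewrite !memX => rz ru;
      have [m] := good_arith_free r_good rz ru; exists m; rewrite memX.
  exact: leq_trans (size_undup _) szX.
have [iota [iotaD iota_br iota_inj]] := ext_embedding freeE spanE br_lie.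
(* [lcs] counts from 1 and [glcs] from 0, whence [k.-1]. The exponent [K] depends on the element;
   exponents add up under brackets and sums. *)
have lift k x : lcs br k x -> exists K, total_span (glcs brV C k.-1) (iota x *~ (N ^+ K)).
  elim=> {k x} [x|k x y _ [K TK]|k|k x y _ [K TK] _ [K' TK']|k x _ [K TK]] /=.
  - exact: decomp.
  - have [K' TK'] := decomp (iota y); exists (K + K')%N.
    have := total_span_br brVDl brVDr TK TK'.
    rewrite (add_mapMz (fun u v => brVDl u v _)) (add_mapMz (brVDr _)) iota_br.
    by rewrite -mulrzA -exprD addnC.
  - by exists 0%N; rewrite (add_map0 iotaD) mul0rz; apply: zspan0.
  - exists (K + K')%N; rewrite iotaD mulrzDl; apply: zspanD.
      by rewrite exprD mulrzA; apply: zspanMz.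
    by rewrite addnC exprD mulrzA; apply: zspanMz.
  by exists K; rewrite (add_mapN iotaD) mulNrz; apply: zspanN.
move=> x /lift[K] /= TK; apply: iota_inj.
have : iota x *~ (N ^+ K) = 0.
  elim: TK => [v [z /C0 //]|//|v w _ -> _ ->]; exact: subr0.
elim: K {TK} => [|K IH]; first by rewrite expr0 mulr1z.
by rewrite exprSr mulrzA => /tfV.
Qed.
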